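(* Let $\mu$ be a centered Borel probability measure on $\mathbb{R}$ which is absolutely continuous with respect to the Lebesgue measure and supported on a compact interval. Let $u:\mathbb{R}\to\mathbb{R}$ be a free moment map of $\mu$, i.e. a convex function with $\mu=(u')_{\sharp}\nu_u$, where $\nu_u$ is the free Gibbs measure associated with $u$. If $u$ is $\mathcal{C}^2$ and $u''>0$ on $\mathbb{R}$, then $$(x,y)\mapsto \frac{x-y}{(u^* )'(x)-(u^* )'(y)}=\frac{x-y}{(u')^{-1}(x)-(u')^{-1}(y)}$$ is a free Stein kernel for $\mu$ with respect to the standard semicircular potential $\tfrac12x^2$.
   Context: Free Gibbs measure: for a convex function $u:\mathbb{R}\to\mathbb{R}$, $\nu_u$ is the unique minimizer, over probability measures $m$ on $\mathbb{R}$, of $-\iint\log|t-s|\,dm(t)dm(s)+\int u(s)\,dm(s)$ (when it exists). For $u(x)=\frac12x^2$ it is the standard semicircular law $\mathcal{S}(0,1)$, with density $\frac1{2\pi}\sqrt{4-x^2}$ on $[-2,2]$. $u^*(y)=\sup_{x}\{xy-u(x)\}$ is the Legendre transform of $u$; under the stated hypotheses $(u^* )'=(u')^{-1}$. $T_\sharp m$ denotes the pushforward of the measure $m$ by $T$. Centered means $\int x\,d\mu(x)=0$. Free Stein kernel (dimension one): for a compactly supported probability measure $\mu$ on $\mathbb{R}$ and a $\mathcal{C}^1$ potential $W$, a free Stein kernel for $\mu$ with respect to $W$ is a function $A\in L^2(\mu\otimes\mu)$, $A:\mathbb{R}^2\to\mathbb{R}$, such that for all test functions $f$ (polynomials) $$\int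 W'(x)f(x)\,d\mu(x)=\iint A(x,y)\frac{f(x)-f(y)}{x-y}\,d\mu(x)d\mu(y),$$ where the difference quotient is read as $f'(x)$ on the diagonal. *)

(* Defs.v *)
From HB Require Import structures.
From mathcomp Require Import all_boot all_order all_algebra.
From mathcomp Require Import all_classical all_reals all_analysis.

Set Implicit Arguments.
Unset Strict Implicit.
Unset Printing Implicit Defensive.

Import Order.TTheory GRing.Theory Num.Theory.
Import numFieldNormedType.Exports.

Local Open Scope ring_scope.
Local Open Scope classical_set_scope.

Definition C2 (R : realType) (u : R -> R) : Prop :=
  [/\ forall x, derivable u x 1,
      forall x, derivable u^`() x 1 &
      continuous u^`(2)].

Definition centered (R : realType) (mu : probability (measurableTypeR R) R) :
  Prop := (\int[mu]_x x%:E = 0)%E.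

Definition compactly_supported (R : realType)
    (mu : probability (measurableTypeR R) R) : Prop :=
  exists a b : R, mu `[a, b] = 1%E.

(* [lne] takes the value -oo at 0, so the diagonal is not discarded. *)
Definition log_dist (R : realType) (z : R * R) : \bar R :=
  lne `|z.1 - z.2|%:E.

Definition gibbs_energy (R : realType) (u : R -> R)
    (m : probability (measurableTypeR R) R) : \bar R :=
  (- (\int[m \x m]_z log_dist z) + \int[m]_s (u s)%:E)%E.

(* Both terms of the energy lie in ]-oo, +oo], i.e. neither integral nor their
   sum is an indeterminate form (which [\int] and [+] on [\bar R] would
   silently evaluate to -oo).
   Discarding the other measures does not affect which measure is the unique
   minimizer: for a convex u tending to +oo at both ends they have
   \int u = +oo and the energy is the meaningless +oo - oo; for any other
   convex u, the compactly supported measures already make the energy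
   arbitrarily negative, and there is no minimizer. *)
Definition gibbs_admissible (R : realType) (u : R -> R)
    (m : probability (measurableTypeR R) R) : Prop :=
  (\int[m \x m]_z (@log_dist R)^\+ z < +oo)%E /\
  (\int[m]_s (EFin \o u)^\- s < +oo)%E.

Definition gibbs_minimizer (R : realType) (u : R -> R)
    (nu : probability (measurableTypeR R) R) : Prop :=
  gibbs_admissible u nu /\
  forall m : probability (measurableTypeR R) R,
    gibbs_admissible u m -> (gibbs_energy u nu <= gibbs_energy u m)%E.

(* Measures are functions on all subsets; two of them are identified when they
   agree on the Borel sets. *)
Definition is_free_gibbs (R : realType) (u : R -> R)
    (nu : probability (measurableTypeR R) R) : Prop :=
  gibbs_minimizer u nu /\
  forall m : probability (measurableTypeR R) R, gibbs_minimizer u m ->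
    forall B : set (measurableTypeR R), measurable B -> m B = nu B.

Definition is_free_moment_map (R : realType)
    (mu : probability (measurableTypeR R) R) (u : R -> R) : Prop :=
  convex_function [set: R^o] u /\
  exists2 nu : probability (measurableTypeR R) R, is_free_gibbs u nu &
    forall B : set (measurableTypeR R), measurable B ->
      mu B = pushforward nu u^`() B.

Definition legendre (R : realType) (u : R -> R) (y : R) : \bar R :=
  ereal_sup [set (x * y - u x)%:E | x in [set: R]].

(* [fine] only matters where the transform is infinite. *)
Definition legendre_deriv (R : realType) (u : R -> R) : R -> R :=
  (fine \o legendre u)^`().

Definition diff_quotient (R : realType) (f : {poly R}) (x y : R) : R :=
  if x == y then (deriv f).[x] else (f.[x] - f.[y]) / (x - y).

Definition is_free_stein_kernel (R : realType)
    (mu : probability (measurableTypeR R) R) (W : R -> R) (A : R -> R -> R) :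
  Prop :=
  (fun z : measurableTypeR R * measurableTypeR R => A z.1 z.2)
    \in Lfun (mu \x mu)%E 2%:E /\
  forall f : {poly R},
    (\int[mu]_x (derive1 W x * f.[x])%:E =
     \int[mu \x mu]_z (A z.1 z.2 * diff_quotient f z.1 z.2)%:E)%E.

Definition semicircular_potential (R : realType) (x : R) : R := x ^+ 2 / 2.

(* Main.v *)
Require Import Defs.
From HB Require Import structures.
From mathcomp Require Import all_boot all_order all_algebra.
From mathcomp Require Import all_classical all_reals all_analysis.
From mathcomp Require Import measurable_realfun.
From mathcomp Require Import ring lra.

Set Implicit Arguments.
Unset Strict Implicit.
Unset Printing Implicit Defensive.

Import Order.TTheory GRing.Theory Num.Theory.
Import numFieldNormedType.Exports.

Local Open Scope ring_scope.
Local Open Scope classical_set_scope.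

(** Let [nu] be the free Gibbs measure of [u], so that [mu] is its image under
    [u'].  The content of the theorem is the Schwinger-Dyson equation of [nu],
      [\int u' g dnu = \int\int (g s - g t) / (s - t) dnu dnu],
    which expresses that the energy of [nu] is stationary when its mass is moved
    by [s |-> s + e * g s].  For [g = f \o u'] the left-hand side is
    [\int x f(x) dmu], and since
      [(f (u' s) - f (u' t)) / (s - t) =
       (u' s - u' t) / (s - t) * (f (u' s) - f (u' t)) / (u' s - u' t)],
    the right-hand side is the double integral of the claimed kernel against the
    difference quotient of [f], whichever left inverse of [u'] defines the kernel.
    Both [pinv [set: R] u'] and [legendre_deriv u] are such inverses
    ([pinv_derivK], [legendre_deriv_at]).

    Three facts make this rigorous.  The energy of [nu] is finite, because [nu]
    does at least as well as the uniform law of the unit interval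
    ([minimizer_has_finite_energy]); this is what allows energies to be
    subtracted.  The support of [nu] is compact ([minimizer_compact_support]):
    as [\int u' dnu = 0], the increasing function [u'] takes both signs and [u]
    grows at least linearly, which beats the logarithm, so that conditioning
    [nu] on a large interval would strictly lower the energy if some mass lay
    outside.  Hence, on this support, [f \o u'] is bounded and Lipschitz; and the
    kernel, seen through [u'], is bounded.  Finally [nu] has no atoms, because [mu] has none and [u']
    is injective, so that the diagonal, where the kernel takes the value
    [0 / 0 = 0], is negligible.

    The variation itself ([schwinger_dyson]) is quantitative: the change of energy
    is bounded by an explicit quadratic polynomial in [e], which has to be
    nonnegative for small [e] of either sign, so that its linear coefficient,
    the difference of the two sides of the equation, vanishes. *)

(** * Elementary calculus *)

(** It bounds the change of the logarithmic energy to second order.  The factor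
    [2] is needed for negative [x]: the bound reduces to [0 <= x ^+ 2 * (1 + 2 * x)]. *)
Lemma ln1D_ge (R : realType) (x : R) :
  - (1 / 2) <= x -> x - 2 * x ^+ 2 <= ln (1 + x).
Proof.
move=> x_ge; have x1_gt0 : 0 < 1 + x by lra.
have -> : ln (1 + x) = - ln (1 + - (x / (1 + x))).
  rewrite (_ : 1 + - (x / (1 + x)) = (1 + x)^-1); first by rewrite lnV ?opprK.
  by field; rewrite gt_eqF.
have := @le_ln1Dx R (- (x / (1 + x))).
have -> : (-1 < - (x / (1 + x))).
  by rewrite ltrN2 ltr_pdivrMr// mul1r; lra.
move=> /(_ isT) le_ln; rewrite lerNr; apply: (le_trans le_ln).
rewrite lerN2 ler_pdivlMr//.
have : 0 <= x ^+ 2 * (1 + 2 * x) by rewrite mulr_ge0 ?sqr_ge0//; lra.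
nra.
Qed.

(** With [d] small, the logarithm loses against any linear growth of [u].  The
    case [z = 0], where [ln z] is [0], is what [d <= 1] is for. *)
Lemma ln_le_linear (R : realType) (d z : R) :
  0 < d -> d <= 1 -> 0 <= z -> ln z <= d * z - ln d.
Proof.
move=> d0 d1; rewrite le_eqVlt => /predU1P[<-|z0].
  by rewrite ln0// mulr0 sub0r oppr_ge0 ln_le0.
rewrite lerBrDr -lnM ?posrE// mulrC.
have := @le_ln1Dx R (d * z - 1).
have -> : -1 < d * z - 1 by have := mulr_gt0 d0 z0; lra.
by rewrite addrC subrK => /(_ isT); lra.
Qed.

Lemma derivable_continuous (R : realType) (f : R -> R) :
  (forall x, derivable f x 1) -> continuous f.
Proof.
by move=> df x; apply: differentiable_continuous; apply/derivable1_diffP.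
Qed.

Lemma mean_value (R : realType) (f : R -> R) (x y : R) :
  (forall x, derivable f x 1) ->
  exists2 c, Num.min x y <= c <= Num.max x y &
    f y - f x = derive1 f c * (y - x).
Proof.
move=> df.
have fd (z : R) : is_derive z 1 f (derive1 f z) by rewrite derive1E; apply: derivableP.
have fc := derivable_continuous df.
case: (leP x y) => xy.
- have [|c cxy e] := @MVT_segment R f (derive1 f) x y xy (fun z _ => fd z).
    exact: continuous_subspaceT.
  by exists c => //; move: cxy; rewrite in_itv.
- have [|c cxy e] := @MVT_segment R f (derive1 f) y x (ltW xy) (fun z _ => fd z).
    exact: continuous_subspaceT.
  exists c; first by move: cxy; rewrite in_itv.
  by rewrite -(opprB (f x)) e -mulrN opprB.
Qed.

Lemma continuous_bounded_on (R : realType) (f : R -> R) (M : R) :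
  continuous f -> exists2 C, 0 <= C & forall x, `|x| <= M -> `|f x| <= C.
Proof.
move=> fc; have [M0|M0] := leP 0 M; last first.
  by exists 0 => // x xM; have := normr_ge0 x; lra.
have [||c cM fmax] := @EVT_max R (fun x => `|f x|) (- M) M.
- lra.
- apply: continuous_subspaceT => x; apply: (@continuous_comp _ _ _ f (fun y => `|y|)).
    exact: fc.
  exact: norm_continuous.
exists `|f c| => // x xM; apply: fmax; rewrite in_itv/=.
by rewrite -ler_norml.
Qed.

(** Both [u'] and a polynomial in [u'] are only locally Lipschitz. *)
Lemma C1_lipschitz_on (R : realType) (f : R -> R) (M : R) :
  (forall x, derivable f x 1) -> continuous (derive1 f) ->
  exists2 C, 0 <= C & forall s t, `|s| <= M -> `|t| <= M ->
    `|f s - f t| <= C * `|s - t|.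
Proof.
move=> df f'c; have [C C0 fC] := continuous_bounded_on M f'c.
exists C => // s t sM tM.
have [c /andP[c1 c2] ->] := mean_value t s df.
rewrite normrM ler_wpM2r// fC//.
by move: sM tM c1 c2; rewrite !ler_norml; case: (leP t s) => ts; lra.
Qed.

(** The inverse with [0^-1 = 0] is continuous off [0] only; it is written here
    with a real power. *)
Lemma measurable_invr (R : realType) : measurable_fun setT (@GRing.inv R).
Proof.
rewrite (_ : @GRing.inv R = fun x => x * (x ^+ 2) `^ (-1)); last first.
  apply/funext => x; rewrite powR_inv1 ?sqr_ge0//.
  have [->|x0] := eqVneq x 0; first by rewrite invr0 mul0r.
  by field.
apply: measurable_funM => //.
apply: (measurableT_comp (measurable_powR _)).
exact: exprn_measurable.
Qed.

(** * Potentials with a positive second derivative *)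

Section strictly_convex.
Context (R : realType) (u : R -> R).
Hypothesis u_C2 : C2 u.
Hypothesis u_pos : forall x, 0 < u^`(2) x.

Local Notation u' := (derive1 u).

Lemma C2_derivable x : derivable u x 1. Proof. by case: u_C2. Qed.

Lemma C2_derivable' x : derivable u' x 1. Proof. by case: u_C2. Qed.

Lemma C2_continuous'' : continuous (derive1 u').
Proof. by case: u_C2 => _ _; rewrite /derive1n/=. Qed.

Lemma C2_continuous' : continuous u'.
Proof. exact/derivable_continuous/C2_derivable'. Qed.

Lemma C2_continuous : continuous u.
Proof. exact/derivable_continuous/C2_derivable. Qed.

Lemma deriv_lt : {mono u' : x y / x < y}.
Proof.
apply: leW_mono; apply: le_mono => x y xy.
have [c _] := mean_value x y C2_derivable'.
by rewrite -subr_gt0 => ->; rewrite mulr_gt0 ?subr_gt0//; exact: u_pos.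
Qed.

Lemma deriv_le : {mono u' : x y / x <= y}.
Proof. by move=> x y; rewrite !leNgt deriv_lt. Qed.

Lemma deriv_inj : injective u'.
Proof. exact: (inc_inj deriv_le). Qed.

Lemma above_tangent x y : u' x * (y - x) <= u y - u x.
Proof.
have [c cxy ->] := mean_value x y C2_derivable.
case: (leP x y) cxy => xy /andP[c1 c2].
- by rewrite ler_wpM2r ?subr_ge0// deriv_le.
- by rewrite -subr_ge0 -mulrBl mulr_le0// subr_le0 ?deriv_le// ltW.
Qed.

Lemma quadratic_upper_bound M :
  exists2 C, 0 <= C & forall s h, `|s| <= M -> `|h| <= 1 ->
    u (s + h) - u s <= u' s * h + C * h ^+ 2.
Proof.
have [C C0 uC] := C1_lipschitz_on (M + 1) C2_derivable' C2_continuous''.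
exists C => // s h sM h1.
have [c cs ->] := mean_value s (s + h) C2_derivable.
have -> : s + h - s = h by lra.
have cM : `|c| <= M + 1 /\ `|c - s| <= `|h|.
  move: sM h1 cs; rewrite !ler_norml.
  case: (leP s (s + h)) => sh.
    by rewrite (@ger0_norm _ h)//; lra.
  by rewrite (@ltr0_norm _ h); lra.
have sM1 : `|s| <= M + 1 by lra.
rewrite -lerBlDl -mulrBl; apply: le_trans (ler_norm _) _.
have -> : h ^+ 2 = `|h| * `|h| by rewrite -normrM ger0_norm ?expr2// -expr2 sqr_ge0.
rewrite normrM mulrA ler_wpM2r//.
apply: le_trans (uC _ _ cM.1 sM1) _; rewrite ler_wpM2l//; exact: cM.2.
Qed.

(** The tangents at [p] and [q] bound [u] from below on the two half-lines. *)
Lemma coercive p q : u' p < 0 -> 0 < u' q ->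
  exists c D, [/\ 0 < c, 0 <= D & forall x, c * `|x| - D <= u x].
Proof.
move=> p0 q0; pose c := Num.min (- u' p) (u' q).
have c0 : 0 < c by rewrite lt_min q0 oppr_gt0 p0.
exists c, (`|u p - u' p * p| + `|u q - u' q * q|).
split; [by []|by rewrite addr_ge0|move=> x]; have := above_tangent p x; have := above_tangent q x.
have cp : c <= - u' p by rewrite ge_min lexx.
have cq : c <= u' q by rewrite ge_min lexx orbT.
have := ler_norm (- (u p - u' p * p)); have := ler_norm (- (u q - u' q * q)).
rewrite !normrN.
have := normr_ge0 (u p - u' p * p); have := normr_ge0 (u q - u' q * q).
case: (leP 0 x) => x0.
  by rewrite (ger0_norm x0); have := ler_wpM2r x0 cq; lra.
have x0' : 0 <= - x by lra.
by rewrite (ltr0_norm x0); have := ler_wpM2r x0' cp; lra.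
Qed.

(** * The Legendre transform *)

Local Notation T := (pinv [set: R] u').
Local Notation F := (fine \o legendre u).

Lemma pinv_derivK : cancel u' T.
Proof. by move=> x; apply: pinvKV; rewrite ?inE// => ? ? _ _; exact: deriv_inj. Qed.

(** The graph of [u] lies above its tangent at [x], so that [x] attains the
    supremum that defines the transform at [u' x]. *)
Lemma legendre_at_deriv x : F (u' x) = x * u' x - u x.
Proof.
rewrite /= (_ : legendre u (u' x) = (x * u' x - u x)%:E)//.
apply/eqP; rewrite eq_le; apply/andP; split.
- apply: ge_ereal_sup => _ [y _ <-]; rewrite lee_fin.
  by have := above_tangent x y; nra.
- by apply: ereal_sup_ubound; exists x.
Qed.

Lemma range_deriv_between a b y : u' a < y < u' b ->
  exists2 x, a < x < b & u' x = y.
Proof.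
move=> /andP[ay yb].
have ab : a <= b by rewrite -deriv_le ltW// (lt_trans ay).
have [||x xab xy] := @IVT R u' a b y ab.
- exact/continuous_subspaceT/C2_continuous'.
- by rewrite ge_min le_max (ltW ay) (ltW yb) orbT.
by exists x => //; rewrite -(deriv_lt a) -(deriv_lt x) xy ay.
Qed.

(** For [y = u' x] and [z = u' w], testing the suprema that define [u^* y] and
    [u^* z] at the other point's maximizer traps the increment
    [u^* z - u^* y] between [x * (z - y)] and [w * (z - y)], so that the
    difference quotient is within [`|w - x|] of [x]. *)
Lemma is_derive_legendre x : is_derive (u' x) 1 F x.
Proof.
apply/is_derive1_caratheodory; set y := u' x.
pose g z := if z == y then x else (F z - F y) / (z - y).
exists g; split; last by rewrite /g eqxx.
  move=> z; rewrite /g; case: eqVneq => [->|zy]; first by rewrite !subrr mulr0.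
  by rewrite divfK// subr_eq0.
have gy : g y = x by rewrite /g eqxx.
apply/cvgrPdist_le => e e0.
near=> z; rewrite gy.
have [w /andP[wl wr] wz] : exists2 w, x - e < w < x + e & u' w = z.
  apply: range_deriv_between.
  have : z \in `]u' (x - e), u' (x + e)[%R.
    near: z; apply: near_in_itvoo; rewrite in_itv/= !deriv_lt; lra.
  by rewrite in_itv.
have we : `|x - w| <= e by rewrite ler_norml; lra.
rewrite /g -wz; case: eqVneq => [_|zy]; first by rewrite subrr normr0 ltW.
apply: le_trans we; rewrite !legendre_at_deriv -/y.
have tx := above_tangent x w; have tw := above_tangent w x.
have zy0 : u' w - y != 0 by rewrite subr_eq0.
set q := w * u' w - u w - (x * y - u x).
have -> : x - q / (u' w - y) = - ((q - x * (u' w - y)) / (u' w - y)) by field.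
rewrite normrN normrM normfV ler_pdivrMr ?normr_gt0// -normrM.
have q1 : 0 <= q - x * (u' w - y) by rewrite /q /y; lra.
have q2 : q - w * (u' w - y) <= 0 by rewrite /q /y; lra.
rewrite ger0_norm// -normrN; apply: le_trans (ler_norm _).
lra.
Unshelve. all: by end_near.
Qed.

Lemma legendre_deriv_at x : legendre_deriv u (u' x) = x.
Proof.
by rewrite /legendre_deriv derive1E; apply: derive_val; exact: is_derive_legendre.
Qed.

(** A potential with slopes at most [d] is at most [u 0 + d * x] for [x >= 0]. *)
Lemma legendre_above d y : (forall x, u' x <= d) -> d < y -> legendre u y = +oo%E.
Proof.
move=> ud dy; apply/eqyP => A A0.
pose x := (A + `|u 0|) / (y - d).
have x0 : 0 <= x by apply: divr_ge0; [have := normr_ge0 (u 0)|]; lra.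
apply: (@le_trans _ _ (x * y - u x)%:E); last by apply: ereal_sup_ubound; exists x.
rewrite lee_fin.
have A0' := ltW A0.
have xE : x * (y - d) = A + `|u 0| by rewrite divfK// gt_eqF// subr_gt0.
have := above_tangent x 0; have := ler_wpM2r x0 (ud x).
have := ler_norm (u 0); lra.
Qed.

Lemma legendre_below c y : (forall x, c <= u' x) -> y < c -> legendre u y = +oo%E.
Proof.
move=> uc yc; apply/eqyP => A A0.
pose x := (A + `|u 0|) / (c - y).
have x0 : 0 <= x by apply: divr_ge0; [have := normr_ge0 (u 0)|]; lra.
apply: (@le_trans _ _ (- x * y - u (- x))%:E); last by apply: ereal_sup_ubound; exists (- x).
rewrite lee_fin.
have A0' := ltW A0.
have xE : x * (c - y) = A + `|u 0| by rewrite divfK// gt_eqF// subr_gt0.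
have := above_tangent (- x) 0; have := ler_wpM2r x0 (uc (- x)).
have := ler_norm (u 0); lra.
Qed.

Lemma range_deriv_itv : is_interval (range u').
Proof.
move=> _ _ [a _ <-] [b _ <-] z /andP[az zb].
move: az; rewrite le_eqVlt => /predU1P[<-|az]; first by exists a.
move: zb; rewrite le_eqVlt => /predU1P[->|zb]; first by exists b.
by have [|x _ <-] := @range_deriv_between a b z; [rewrite az zb|exists x].
Qed.

Lemma measurable_range_deriv : @measurable _ (measurableTypeR R) (range u').
Proof. exact: (is_interval_measurable range_deriv_itv). Qed.

(** Off the closure of the interval [range u'] the transform is infinite, so that
    its real-valued version vanishes there, and so does its derivative.  Nothing
    is claimed at the endpoints; where one of them is infinite, [inf] or [sup]
    is [0], and excluding that point does no harm. *)
Lemma legendre_deriv_off_range y : ~ range u' y ->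
  y != inf (range u') -> y != sup (range u') -> legendre_deriv u y = 0.
Proof.
move=> yI yinf ysup.
have flat (f : R -> R) : (\near y, f y = cst 0 y) -> derive1 f y = 0.
  by move=> f0; rewrite derive1E (near_eq_derive _ f0) derive_cst.
have neq x : y != u' x by apply: contra_notN yI => /eqP ->; exists x.
apply: flat.
have [[a ya]|above] := pselect (exists a, u' a > y).
- have below x : y < u' x.
    rewrite lt_neqAle neq/= leNgt; apply: contra_notN yI => uxy.
    by have [|w _ <-] := @range_deriv_between x a y; [rewrite uxy ya|exists w].
  have hasinf : has_inf (range u').
    by split; [exists (u' a), a|exists y => _ [x _ <-]; exact: ltW].
  have yi : y < inf (range u').
    rewrite lt_neqAle yinf; apply: lb_le_inf; first by exists (u' a), a.
    by move=> _ [x _ <-]; exact: ltW.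
  near=> z; rewrite /= (@legendre_below (inf (range u')))//.
    by move=> x; apply: ge_inf; [case: hasinf|exists x].
  by near: z; exact: lt_nbhsl.
- have ub x : u' x <= y by rewrite leNgt; apply/negP => h; apply: above; exists x.
  have hassup : has_sup (range u').
    by split; [exists (u' 0), 0|exists y => _ [x _ <-]].
  have yi : sup (range u') < y.
    rewrite lt_neqAle eq_sym ysup; apply: ge_sup; first by exists (u' 0), 0.
    by move=> _ [x _ <-].
  near=> z; rewrite /= (@legendre_above (sup (range u')))//.
    by move=> x; apply: ub_le_sup; [case: hassup|exists x].
  by near: z; exact: lt_nbhsr.
Unshelve. all: by end_near.
Qed.

(** On the interval [range u'] an increasing left inverse of [u'] pulls the ray
    [`[a, +oo[] back to the ray [`[u' a, +oo[]. *)
Lemma measurable_left_inverse (S : measurableTypeR R -> measurableTypeR R) :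
  (forall x, S (u' x) = x) -> measurable_fun (range u') S.
Proof.
move=> SK mI; apply: (measurability _ (RGenCInfty.measurableE R)) => //.
move=> _ [_ [a ->] <-].
have -> : range u' `&` S @^-1` `[a, +oo[%classic = range u' `&` `[u' a, +oo[%classic.
  apply/seteqP; split => [_ [[x _ <-]]|_ [[x _ <-]]] /=;
  by rewrite !in_itv/= !andbT SK deriv_le => ax; split => //; exists x.
by apply: measurableI; [exact: measurable_range_deriv|exact: measurable_itv].
Qed.

(** Off [range u'] the partial inverse is constant. *)
Lemma measurable_pinv_deriv (S := T : R -> R) :
  measurable_fun setT (S : measurableTypeR R -> measurableTypeR R).
Proof.
have mI := measurable_range_deriv.
rewrite -(setUv (range u')); apply/(measurable_funU _ mI (measurableC mI)).
split; first by apply: measurable_left_inverse; exact: pinv_derivK.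
apply: (eq_measurable_fun (cst point)); last exact: measurable_cst.
(* the definition of the partial inverse, unfolded *)
move=> y /set_mem yI; have -> : S y = odflt point (if pselect (range u' y) is left Iy
    then Some (projT1 (cid2 Iy)) else None) by [].
by case: pselect.
Qed.

(** The endpoints of [range u'], where the derivative is unknown, form a finite
    set, on which every function is measurable. *)
Lemma measurable_legendre_deriv : measurable_fun setT
  (legendre_deriv u : measurableTypeR R -> measurableTypeR R).
Proof.
have mI := measurable_range_deriv.
pose E : set (measurableTypeR R) := [set inf (range u'); sup (range u')].
have mE : measurable E by apply: measurableU; exact: measurable_set1.
rewrite -(setUv (range u')); apply/(measurable_funU _ mI (measurableC mI)).
split; first by apply: measurable_left_inverse => x; rewrite legendre_deriv_at.
apply: (@measurable_funS _ _ _ _ ((~` range u' `\` E) `|` E)).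
- by apply: measurableU => //; apply: measurableD => //; exact: measurableC.
- by move=> x Ix; have [|] := pselect (E x); [right|left].
have mD : @measurable _ (measurableTypeR R) (~` range u' `\` E).
  by apply: measurableD => //; exact: measurableC.
apply/(measurable_funU _ mD mE); split.
- apply: (eq_measurable_fun (cst (0 : R))); last exact: measurable_cst.
  move=> y /set_mem[yI /not_orP[/eqP y1 /eqP y2]].
  by rewrite legendre_deriv_off_range.
- apply/measurable_funU; last by split; exact: measurable_fun_set1.
  all: exact: measurable_set1.
Qed.

End strictly_convex.

(** * Transfer of integrals between measures *)

Section image_measure.
Context d1 d2 (X : measurableType d1) (Y : measurableType d2) (R : realType).
Context (phi : X -> Y) (n : {measure set X -> \bar R})
  (m : {measure set Y -> \bar R}).
Hypothesis mphi : measurable_fun setT phi.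
Hypothesis m_image : forall B, measurable B -> m B = n (phi @^-1` B).

Lemma ge0_integral_image (f : Y -> \bar R) :
  measurable_fun setT f -> (forall y, 0 <= f y)%E ->
  (\int[m]_y f y = \int[n]_x f (phi x))%E.
Proof.
move=> mf f0.
rewrite (eq_measure_integral (pushforward n phi)); last first.
  by move=> A mA _; rewrite m_image.
by rewrite ge0_integral_pushforward// => y _; exact: f0.
Qed.

Lemma integral_image (f : Y -> \bar R) : measurable_fun setT f ->
  (\int[m]_y f y = \int[n]_x f (phi x))%E.
Proof.
move=> mf; rewrite [LHS]integralE [RHS]integralE; congr (_ - _)%E.
- rewrite (ge0_integral_image (measurable_funepos mf) (funepos_ge0 f)).
  by apply: eq_integral => x _; rewrite (funepos_comp f phi).
- rewrite (ge0_integral_image (measurable_funeneg mf) (funeneg_ge0 f)).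
  by apply: eq_integral => x _; rewrite (funeneg_comp f phi).
Qed.

Lemma integrable_image (f : Y -> \bar R) : measurable_fun setT f ->
  m.-integrable setT f <-> n.-integrable setT (f \o phi).
Proof.
move=> mf; split => /integrableP[_ fi]; apply/integrableP; split => //.
- exact: measurableT_comp.
- move: fi; rewrite ge0_integral_image//; exact: measurableT_comp.
- rewrite ge0_integral_image//; exact: measurableT_comp.
Qed.

End image_measure.

Section restricted_measure.
Context d (T : measurableType d) (R : realType).
Context (n m : {measure set T -> \bar R}) (K : set T) (c : {nonneg R}).
Hypothesis mK : measurable K.
Hypothesis m_on : forall A, measurable A -> A `<=` K -> m A = (c%:num%:E * n A)%E.
Hypothesis m_off : m (~` K) = 0%E.

Lemma ge0_integral_restricted (f : T -> \bar R) :
  measurable_fun setT f -> (forall y, 0 <= f y)%E ->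
  (\int[m]_x f x = c%:num%:E * \int[n]_(x in K) f x)%E.
Proof.
move=> mf f0; rewrite (@ge0_negligible_integral _ _ _ _ _ (~` K))//; last first.
  exact: measurableC.
rewrite setDE setCK setTI -ge0_integral_mscale//; last exact: measurable_funTS.
by apply: eq_measure_integral => A mA AK; rewrite m_on.
Qed.

Lemma integral_restricted (f : T -> \bar R) : n.-integrable K f ->
  measurable_fun setT f ->
  (\int[m]_x f x = c%:num%:E * \int[n]_(x in K) f x)%E.
Proof.
move=> fi mf; rewrite (integralE m) (integralE n).
rewrite (ge0_integral_restricted (measurable_funepos mf) (funepos_ge0 f)).
rewrite (ge0_integral_restricted (measurable_funeneg mf) (funeneg_ge0 f)).
rewrite [RHS]muleBr//; apply: fin_num_adde_defl; rewrite fin_numN.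
exact: integrable_neg_fin_num.
Qed.

Lemma integrable_restricted (f : T -> \bar R) : n.-integrable K f ->
  measurable_fun setT f -> m.-integrable setT f.
Proof.
move=> /integrableP[_ fi] mf; apply/integrableP; split => //.
rewrite ge0_integral_restricted//; last exact: measurableT_comp.
by rewrite lte_mul_pinfty.
Qed.

End restricted_measure.

(** * Product measures *)

Section product.
Context (R : realType).
Local Notation TR := (measurableTypeR R).
Implicit Types m n : probability TR R.

Lemma product_setT m : (m \x m)%E setT = 1%E.
Proof.
have := @product_measure1E _ _ _ _ _ m m setT setT measurableT measurableT.
rewrite setXTT => ->; rewrite -[RHS]mule1; congr (_ * _)%E; exact: probability_setT.
Qed.

(** Both sides are measures that agree on rectangles, which determine a product
    measure. *)
Lemma product_image m n (phi : TR -> TR) : measurable_fun setT phi ->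
  (forall B, measurable B -> m B = n (phi @^-1` B)) ->
  forall X, measurable X ->
    (m \x m)%E X = (n \x n)%E ((fun z => (phi z.1, phi z.2)) @^-1` X).
Proof.
move=> mphi mn X mX.
have mphi2 : measurable_fun setT (fun z : TR * TR => (phi z.1, phi z.2)).
  by apply: measurable_fun_pair; apply: measurableT_comp.
have mpre C : measurable C -> measurable (phi @^-1` C).
  by move=> mC; rewrite -[X in measurable X]setTI; exact: mphi.
apply: (@product_measure_unique _ _ _ _ _ m m
  (pushforward (n \x n)%E (fun z : TR * TR => (phi z.1, phi z.2)))) => // A B mA mB.
change ((n \x n)%E ((phi @^-1` A) `*` (phi @^-1` B)) = (m A * m B)%E).
by rewrite product_measure1E ?(mn _ mA) ?(mn _ mB)//; exact: mpre.
Qed.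

Lemma product_restricted m n (K : set TR) (c : {nonneg R}) : measurable K ->
  (forall A, measurable A -> m A = (c%:num%:E * n (A `&` K))%E) ->
  forall X, measurable X -> X `<=` K `*` K ->
    (m \x m)%E X = ((c%:num ^+ 2)%:E * (n \x n)%E X)%E.
Proof.
move=> mK mn X mX XK.
have c2_ge0 : 0 <= c%:num ^+ 2 by rewrite exprn_ge0.
pose c2 := NngNum c2_ge0.
have mKK : measurable (K `*` K) by exact: measurableX.
have mE A B : measurable A -> measurable B ->
    mscale c2 (mrestr (n \x n)%E mKK) (A `*` B) = (m A * m B)%E.
  move=> mA mB; rewrite (mn _ mA) (mn _ mB) muleACA -EFinM.
  rewrite -product_measure1E; try exact: measurableI.
  by rewrite setXI.
rewrite (product_measure_unique mE mX).
change (c2%:num%:E * (n \x n)%E (X `&` (K `*` K)) = c2%:num%:E * (n \x n)%E X)%E.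
by rewrite setIidl.
Qed.

Lemma product_square m (K : set TR) (p : R) : measurable K -> m K = p%:E ->
  (m \x m)%E (K `*` K) = (p ^+ 2)%:E /\
  (m \x m)%E (~` (K `*` K)) = (1 - p ^+ 2)%:E.
Proof.
move=> mK mKp; have mKK : measurable (K `*` K) by exact: measurableX.
have KK : (m \x m)%E (K `*` K) = (p ^+ 2)%:E.
  transitivity (m K * m K)%E; first exact: product_measure1E.
  by rewrite mKp -EFinM.
split => //.
have : (m \x m)%E setT = ((m \x m)%E (K `*` K) + (m \x m)%E (~` (K `*` K)))%E.
  by rewrite -measureU ?setUv ?setICr//; exact: measurableC.
rewrite KK product_setT.
case: ((m \x m)%E _) (measure_ge0 (m \x m)%E (~` (K `*` K))) => [r _| |]//.
by rewrite -EFinD => -[->]; congr _%:E; lra.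
Qed.

Lemma product_on m (K : set TR) : measurable K -> m K = 1%E ->
  (m \x m)%E (K `*` K) = 1%E.
Proof. by move=> mK /(product_square mK)[-> _]; rewrite expr1n. Qed.

Lemma product_off m (K : set TR) : measurable K -> m K = 1%E ->
  (m \x m)%E (~` (K `*` K)) = 0%E.
Proof. by move=> mK /(product_square mK)[_ ->]; rewrite expr1n subrr. Qed.

(** Each section of the diagonal is a single point. *)
Lemma diagonal_null m : (forall x, m [set x] = 0%E) ->
  measurable [set z : TR * TR | z.1 = z.2] /\
  (m \x m)%E [set z | z.1 = z.2] = 0%E.
Proof.
move=> m0; split.
  rewrite (_ : [set z | _] = (fun z : TR * TR => (z.1 : R) - z.2) @^-1` [set 0]); last first.
    by apply/seteqP; split => z /=; [move=> ->; rewrite subrr|move/subr0_eq].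
  rewrite -[X in measurable X]setTI.
  have mf : measurable_fun setT (fun z : TR * TR => (z.1 : R) - z.2).
    by apply: measurable_funB; [exact: measurable_fst|exact: measurable_snd].
  by apply: mf => //; exact: measurable_set1.
rewrite /product_measure1; apply: integral0_eq => x _ /=.
rewrite (_ : xsection _ _ = [set x])//; apply/seteqP; split => y.
  by rewrite /xsection/= inE/= => ->.
by move=> ->; rewrite /xsection/= inE.
Qed.

End product.

(** * Finiteness of the logarithmic energy of a uniform law *)

(** The real-valued [log_dist]; they differ on the diagonal only, where [log_gap]
    is [ln 0 = 0]. *)
Definition log_gap (R : realType) (z : measurableTypeR R * measurableTypeR R) : R :=
  ln `|(z.1 : R) - z.2|.

Lemma measurable_log_gap (R : realType) :
  measurable_fun setT (@log_gap R).
Proof.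
apply: (measurableT_comp (@measurable_ln R)); apply: measurableT_comp => //.
by apply: measurable_funB; [exact: measurable_fst|exact: measurable_snd].
Qed.

Definition dyadic_ball (R : realType) (x : R) (k : nat) : set (measurableTypeR R) :=
  `[x - 2^-1 ^+ k, x + 2^-1 ^+ k].

(** With [t = |x - y|] and [N] the integer part of [- ln t], the point [y] lies in
    each of the balls of index [0, ..., N], since [t <= e^-k <= 2^-k] for
    [k <= N]; and [- ln t < N + 1]. *)
Lemma normr_ln_le_count (R : realType) (x y : R) : `|x - y| <= 1 ->
  (`|ln `|x - y| |%:E <= \sum_(0 <= k <oo) (\1_(dyadic_ball x k) y)%:E)%E.
Proof.
set t := `|x - y| => t1.
have lnt : ln t <= 0 by rewrite ln_le0.
rewrite ler0_norm//.
have := normr_ge0 (x - y); rewrite -/t le_eqVlt => /predU1P[<-|t0].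
  by rewrite ln0// oppr0 nneseries_ge0// => n _ _; rewrite lee_fin.
pose N := Num.truncn (- ln t).
have Nln : N%:R <= - ln t by rewrite truncn_le ?oppr_ge0.
apply: (@le_trans _ _ (\sum_(0 <= k < N.+1) (\1_(dyadic_ball x k) y)%:E)%E); last first.
  by apply: nneseries_lim_ge => n _ _; rewrite lee_fin.
rewrite sumEFin lee_fin (eq_big_nat _ _ (F2 := fun=> 1)); last first.
  move=> k /andP[_ kN]; rewrite indicE mem_set// /dyadic_ball/= in_itv/=.
  have tk : t <= 2^-1 ^+ k.
    rewrite -(lnK t0) (@le_trans _ _ (expR (k%:R * -1)))//.
      rewrite ler_expR mulrN1 lerNr (le_trans _ Nln)// ler_nat; exact: kN.
    rewrite expRM_natl lerXn2r ?nnegrE ?expR_ge0 ?invr_ge0//.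
    rewrite expRN lef_pV2 ?posrE ?expR_gt0//.
    by have := expR_ge1Dx (1 : R); lra.
  by move: tk; rewrite /t distrC ler_distl.
rewrite sumr_const_nat subn0.
have lnt' : 0 <= - ln t by rewrite oppr_ge0.
by have /andP[_ /ltW] := truncn_itv lnt'.
Qed.

Lemma lebesgue_dyadic_ball (R : realType) (x : R) (k : nat) :
  lebesgue_measure (dyadic_ball x k) = (4 / (2 ^ k.+1)%:R)%:E.
Proof.
rewrite /dyadic_ball lebesgue_measure_itv/= lte_fin.
have h : 0 < 2^-1 ^+ k :> R by rewrite exprn_gt0// invr_gt0.
rewrite ifT; last by lra.
rewrite -EFinD; congr _%:E; rewrite expnS natrM natrX exprVn.
by field; rewrite expf_neq0.
Qed.

(** The ball of index [k] has length [2 * 2^-k], and these lengths add up to [4]. *)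
Lemma integral_log_le (R : realType) (x : R) : 0 <= x <= 1 ->
  (\int[lebesgue_measure]_(y in `[0%R, 1%R]) `|ln `|x - y| |%:E <= (4 : R)%:E)%E.
Proof.
move=> x01.
have mi k : measurable (dyadic_ball x k) by exact: measurable_itv.
have mf k : measurable_fun setT (fun y : measurableTypeR R => (\1_(dyadic_ball x k) y)%:E : \bar R).
  by apply/measurable_EFinP; exact: measurable_indic.
apply: (@le_trans _ _ (\int[lebesgue_measure]_(y in `[0%R, 1%R])
   \sum_(0 <= k <oo) (\1_(dyadic_ball x k) y)%:E)%E).
  apply: ge0_le_integral => //.
  - apply/measurable_EFinP/measurable_funTS.
    apply: measurableT_comp => //; apply: (measurableT_comp (@measurable_ln R)).
    by apply: measurableT_comp => //; exact: measurable_funB.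
  - apply: measurable_funTS; exact: ge0_emeasurable_sum.
  - move=> y; rewrite /= in_itv/= => y01; apply: normr_ln_le_count.
    by rewrite ler_norml; lra.
rewrite integral_nneseries//; last by move=> k; exact: measurable_funTS.
apply: le_trans (epsilon_trick0 xpredT _) => //.
apply: lee_nneseries => [k _ _|k _]; first exact: integral_ge0.
rewrite -(lebesgue_dyadic_ball x) integral_indic//.
by apply: le_measure; rewrite ?inE//; exact: measurableI.
Qed.

Lemma dominated_atomless (R : realType) (m : probability (measurableTypeR R) R) :
  m `<< (@lebesgue_measure R) -> forall x, m [set x] = 0%E.
Proof.
move=> /null_content_dominatesP m_dom x; apply: m_dom.
  exact: measurable_set1.
exact: lebesgue_measure_set1.
Qed.

Definition uniform01 (R : realType) : probability (measurableTypeR R) R :=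
  uniform_prob (@ltr01 R).

Lemma uniform01_atomless (R : realType) (x : R) : uniform01 R [set x] = 0%E.
Proof. by apply: dominated_atomless; exact: dominates_uniform_prob. Qed.

Lemma integral_uniform01 (R : realType) (f : measurableTypeR R -> \bar R) :
  measurable_fun setT f -> (forall x, 0 <= f x)%E ->
  (\int[uniform01 R]_x f x = \int[lebesgue_measure]_(x in `[0%R, 1%R]) f x)%E.
Proof. by move=> mf f0; rewrite integral_uniform// subr0 invr1 mul1e. Qed.

Lemma uniform01_log_gap_integrable (R : realType) :
  (uniform01 R \x uniform01 R)%E.-integrable setT (EFin \o @log_gap R).
Proof.
have mg := @measurable_log_gap R.
have mag : measurable_fun setT (fun z : measurableTypeR R * measurableTypeR R => `|log_gap z|%:E).
  by apply/measurable_EFinP; exact: measurableT_comp.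
apply/integrableP; split; first exact/measurable_EFinP.
rewrite [ltLHS](_ : _ = \int[uniform01 R \x uniform01 R]_z `|log_gap z|%:E)%E//.
rewrite (fubini_tonelli1 _ mag)//.
rewrite integral_uniform01; last 2 first.
- exact: measurable_fun_fubini_tonelli_F.
- by move=> x; apply: integral_ge0 => y _; rewrite lee_fin.
apply: (@le_lt_trans _ _ (\int[lebesgue_measure]_(x in `[0%R, 1%R]) cst (4 : R)%:E x)%E).
  apply: ge0_le_integral => //.
  - by move=> x _; apply: integral_ge0 => y _; rewrite lee_fin.
  - by apply: measurable_funTS; exact: measurable_fun_fubini_tonelli_F.
  - move=> x; rewrite /= in_itv/= => x01; rewrite /fubini_F.
    rewrite integral_uniform01//; first exact: integral_log_le.
    exact: (measurableT_comp mag (measurable_pair1 x)).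
rewrite integral_cst//= lebesgue_measure_itv/= lte_fin ltr01 -EFinD -EFinM.
exact: ltry.
Qed.

(** * The free energy as a real number *)

Section energy.
Context (R : realType).
Local Notation TR := (measurableTypeR R).
Implicit Types (u : R -> R) (m : probability TR R).

Lemma log_distE (z : TR * TR) : z.1 <> z.2 -> log_dist z = (log_gap z)%:E.
Proof. by move=> /eqP z12; rewrite /log_dist lne_EFin// normr_gt0 subr_eq0. Qed.

Lemma funepos_log_dist : (@log_dist R)^\+%E = (EFin \o @log_gap R)^\+%E.
Proof.
apply/funext => z; have [z12|z12] := pselect (z.1 = z.2).
  rewrite !funeposE/= /log_dist /log_gap z12 subrr normr0 le0_lneNy// ln0//.
  by rewrite maxNye maxxx.
by rewrite !funeposE/= log_distE.
Qed.

Lemma measurable_log_dist : measurable_fun [set: TR * TR] (@log_dist R).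
Proof.
rewrite (_ : @log_dist R =
    fun z : TR * TR => if (z.1 : R) == z.2 then -oo%E else (log_gap z)%:E).
  apply: measurable_fun_ifT.
  - by apply: measurable_fun_eqr; [exact: measurable_fst|exact: measurable_snd].
  - exact: measurable_cst.
  - by apply/measurable_EFinP; exact: measurable_log_gap.
apply/funext => z; case: eqP => [z12|/log_distE//].
by rewrite /log_dist z12 subrr normr0 le0_lneNy.
Qed.

Lemma integral_log_dist m : (forall x, m [set x] = 0%E) ->
  (\int[m \x m]_z log_dist z = \int[m \x m]_z (log_gap z)%:E)%E.
Proof.
move=> /diagonal_null[mD D0]; apply: ae_eq_integral => //.
- exact: measurable_log_dist.
- by apply/measurable_EFinP; exact: measurable_log_gap.
exists [set z | z.1 = z.2]; split => // z /= h.
by apply: contrapT => z12; apply: h => _; exact: log_distE.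
Qed.

(** The laws among which energies are real numbers that can be compared. *)
Definition has_finite_energy u m : Prop :=
  [/\ forall x, m [set x] = 0%E,
      (m \x m)%E.-integrable setT (EFin \o @log_gap R) &
      m.-integrable setT (EFin \o u : TR -> \bar R)].

Definition energy u m : R :=
  \int[m]_x u x - \int[(m \x m)%E]_z log_gap z.

Lemma integrable_EFin_fineK d (T : measurableType d)
    (n : {measure set T -> \bar R}) (f : T -> R) :
  n.-integrable setT (EFin \o f) ->
  (\int[n]_x (f x)%:E = (\int[n]_x f x)%:E)%E.
Proof. by move=> fi; rewrite fineK//; exact: integrable_fin_num. Qed.

Lemma gibbs_energyE u m : has_finite_energy u m ->
  gibbs_admissible u m /\ gibbs_energy u m = (energy u m)%:E.
Proof.
move=> [m0 li ui]; split; first split.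
- by rewrite funepos_log_dist; apply: integral_funepos_lt_pinfty.
- exact: integral_funeneg_lt_pinfty.
rewrite /gibbs_energy integral_log_dist// !integrable_EFin_fineK//.
by rewrite -EFinN -EFinD addrC.
Qed.

Lemma integrable_posneg d (T : measurableType d)
    (n : {measure set T -> \bar R}) (f : T -> \bar R) :
  measurable_fun setT f ->
  (\int[n]_x f^\+ x < +oo)%E -> (\int[n]_x f^\- x < +oo)%E ->
  n.-integrable setT f.
Proof.
move=> mf fp fn; apply/integrableP; split => //.
rewrite (_ : (fun x => `|f x|)%E = (f^\+ \+ f^\-)%E); last by rewrite -fune_abse.
rewrite ge0_integralD//; first exact: lte_add_pinfty.
- exact: measurable_funepos.
- exact: measurable_funeneg.
Qed.

Lemma uniform01_has_finite_energy u : continuous u ->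
  has_finite_energy u (uniform01 R).
Proof.
move=> uc; split; [exact: uniform01_atomless|exact: uniform01_log_gap_integrable|].
have mu : measurable_fun setT (u : TR -> R) by exact: continuous_measurable_fun.
have mau : measurable_fun setT (fun x : TR => `|u x|%:E).
  by apply/measurable_EFinP; exact: measurableT_comp.
have [C C0 uC] := continuous_bounded_on 1 uc.
apply/integrableP; split; first exact/measurable_EFinP.
rewrite [ltLHS](_ : _ = \int[uniform01 R]_z `|u z|%:E)%E//.
rewrite integral_uniform01//.
apply: (@le_lt_trans _ _ (\int[lebesgue_measure]_(x in `[0%R, 1%R]) cst C%:E x)%E).
  apply: ge0_le_integral => //.
    exact: measurable_funTS.
  move=> x; rewrite /= in_itv/= => x01; rewrite lee_fin uC//.
  by rewrite ler_norml; lra.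
rewrite integral_cst//= lebesgue_measure_itv/= lte_fin ltr01 -EFinD -EFinM.
exact: ltry.
Qed.

Lemma ereal_terms_finite (p n a b : \bar R) (e : R) :
  (p < +oo -> 0 <= p -> 0 <= n -> b < +oo -> 0 <= b -> 0 <= a ->
   - (p - n) + (a - b) <= e%:E -> n < +oo /\ a < +oo)%E.
Proof.
by case: p n a b => [p| |] [n| |] [a| |] [b| |]// *; rewrite ?ltry.
Qed.

(** A minimizer does at least as well as the uniform law, whose energy is
    finite; as neither [- \int\int log] nor [\int u] can be [-oo] for an
    admissible measure, both are finite. *)
Lemma minimizer_has_finite_energy u (nu : probability TR R) : continuous u ->
  (forall x, nu [set x] = 0%E) -> gibbs_minimizer u nu ->
  has_finite_energy u nu.
Proof.
move=> uc nu0 [[lp un] /(_ (uniform01 R))].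
have [adm ->] := gibbs_energyE (uniform01_has_finite_energy uc).
move=> /(_ adm) le_unif.
have mu : measurable_fun setT (EFin \o u : TR -> \bar R).
  by apply/measurable_EFinP; exact: continuous_measurable_fun.
have ml : measurable_fun setT (EFin \o @log_gap R).
  by apply/measurable_EFinP; exact: measurable_log_gap.
move: lp le_unif; rewrite funepos_log_dist /gibbs_energy integral_log_dist//.
rewrite (integralE (nu \x nu)%E _ (EFin \o @log_gap R)) (integralE nu) => lp.
have lp0 := integral_ge0 (nu \x nu)%E (fun z (_ : setT z) => funepos_ge0 (EFin \o @log_gap R) z).
have ln0 := integral_ge0 (nu \x nu)%E (fun z (_ : setT z) => funeneg_ge0 (EFin \o @log_gap R) z).
have up0 := integral_ge0 nu (fun z (_ : setT z) => funepos_ge0 (EFin \o u) z).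
have un0 := integral_ge0 nu (fun z (_ : setT z) => funeneg_ge0 (EFin \o u) z).
move=> /(ereal_terms_finite lp lp0 ln0 un un0 up0)[ln up].
by split => //; apply: integrable_posneg.
Qed.

Lemma minimizer_le u nu m : has_finite_energy u nu -> gibbs_minimizer u nu ->
  has_finite_energy u m -> energy u nu <= energy u m.
Proof.
move=> nu_fin [_ nu_min] /gibbs_energyE[adm Em].
have := nu_min m adm.
by rewrite Em; have [_ ->] := gibbs_energyE nu_fin; rewrite lee_fin.
Qed.

End energy.

(** * Minimizers have compact support *)

Section full_set.
Context d (T : measurableType d) (R : realType) (m : {measure set T -> \bar R}).
Context (K : set T).
Hypothesis mK : measurable K.
Hypothesis m_off : m (~` K) = 0%E.

Lemma integrable_bounded_on (f : T -> R) (C : R) : (m K < +oo)%E ->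
  measurable_fun setT f -> (forall x, K x -> `|f x| <= C) ->
  m.-integrable setT (EFin \o f).
Proof.
move=> Koo mf fC; apply/integrableP; split; first exact/measurable_EFinP.
have maf : measurable_fun setT (fun x => `|f x|%:E : \bar R).
  by apply/measurable_EFinP; exact: measurableT_comp.
rewrite [ltLHS](_ : _ = \int[m]_z `|f z|%:E)%E//.
rewrite (@ge0_negligible_integral _ _ _ _ _ (~` K))//; last exact: measurableC.
rewrite setDE setCK setTI.
apply: (@le_lt_trans _ _ (\int[m]_(x in K) cst (`|C|%:E) x)%E).
  apply: ge0_le_integral => //.
    exact: measurable_funTS.
  by move=> x /fC fx; rewrite lee_fin (le_trans fx)// ler_norm.
by rewrite integral_cst// lte_mul_pinfty// lee_fin.
Qed.

Lemma Rintegral_full (f : T -> R) : m.-integrable setT (EFin \o f) ->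
  \int[m]_x f x = \int[m]_(x in K) f x.
Proof.
move=> fi; rewrite /Rintegral; congr fine.
rewrite (@negligible_integral _ _ _ _ _ (~` K))//; last exact: measurableC.
by rewrite setDE setCK setTI.
Qed.

Lemma le_Rintegral_full (f g : T -> R) : m.-integrable setT (EFin \o f) ->
  m.-integrable setT (EFin \o g) -> (forall x, K x -> f x <= g x) ->
  \int[m]_x f x <= \int[m]_x g x.
Proof.
move=> fi gi fg; rewrite (Rintegral_full fi) (Rintegral_full gi).
by apply: le_Rintegral => //; exact: integrableS fi || exact: integrableS gi.
Qed.

End full_set.

Section confinement.
Context (R : realType).
Local Notation TR := (measurableTypeR R).
Implicit Types (u : R -> R) (m nu : probability TR R).

Lemma product_fst m (B : set TR) : measurable B ->
  m B = (m \x m)%E (fst @^-1` B).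
Proof.
move=> mB; have -> : fst @^-1` B = B `*` [set: TR].
  by apply/seteqP; split => z //= [].
transitivity (m B * m setT)%E; last by apply/esym; exact: product_measure1E.
by rewrite [X in (_ * X)%E](_ : _ = 1%E) ?mule1//; exact: probability_setT.
Qed.

Lemma product_snd m (B : set TR) : measurable B ->
  m B = (m \x m)%E (snd @^-1` B).
Proof.
move=> mB; have -> : snd @^-1` B = [set: TR] `*` B.
  by apply/seteqP; split => z //= [].
transitivity (m setT * m B)%E; last by apply/esym; exact: product_measure1E.
by rewrite [X in (X * _)%E](_ : _ = 1%E) ?mul1e//; exact: probability_setT.
Qed.

(** Spreading the potential over both variables turns the energy into a single
    double integral. *)
Definition energy_kernel u (z : TR * TR) : R :=
  (u z.1 + u z.2) / 2 - log_gap z.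

Lemma energy_kernelE u m : has_finite_energy u m ->
  (m \x m)%E.-integrable setT (EFin \o energy_kernel u) /\
  \int[(m \x m)%E]_z energy_kernel u z = energy u m.
Proof.
move=> [m0 li ui].
have mu := measurable_int _ ui.
have u1 : (m \x m)%E.-integrable setT (EFin \o (fun z : TR * TR => u z.1)).
  have := integrable_image measurable_fst (product_fst m) mu.
  by move=> [/(_ ui)].
have u2 : (m \x m)%E.-integrable setT (EFin \o (fun z : TR * TR => u z.2)).
  have := integrable_image measurable_snd (product_snd m) mu.
  by move=> [/(_ ui)].
have i1 : \int[(m \x m)%E]_z u z.1 = \int[m]_x u x.
  by rewrite /Rintegral (integral_image measurable_fst (product_fst m) mu).
have i2 : \int[(m \x m)%E]_z u z.2 = \int[m]_x u x.
  by rewrite /Rintegral (integral_image measurable_snd (product_snd m) mu).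
have u12 : (m \x m)%E.-integrable setT (EFin \o (fun z : TR * TR => u z.1 + u z.2)).
  exact: integrableD u1 u2.
have u12h : (m \x m)%E.-integrable setT (EFin \o (fun z : TR * TR => 2^-1 * (u z.1 + u z.2))).
  exact: (integrableZl measurableT 2^-1 u12).
have kE : energy_kernel u = (fun z : TR * TR => 2^-1 * (u z.1 + u z.2) - log_gap z).
  by apply/funext => z; rewrite /energy_kernel mulrC.
rewrite kE; split; first exact: integrableB u12h li.
rewrite RintegralB// RintegralZl// RintegralD// i1 i2 /energy.
by congr (_ - _); field.
Qed.

Lemma null_complement m (K : set TR) : measurable K ->
  m K = 1%E -> m (~` K) = 0%E.
Proof. by move=> mK mK1; rewrite probability_setC// mK1 subee. Qed.

(** Conditioning [nu] on [K] divides integrals over [K] by [nu K], and double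
    integrals over [K `*` K] by its square. *)
Lemma conditioned_energy u nu (K : set TR) : measurable K -> nu K != 0%E ->
  has_finite_energy u nu ->
  exists m, has_finite_energy u m /\
    \int[(nu \x nu)%E]_(z in K `*` K) energy_kernel u z =
    fine (nu K) ^+ 2 * energy u m.
Proof.
move=> mK K0 nu_fin; have [nu0 li ui] := nu_fin.
have mKK : measurable (K `*` K) by exact: measurableX.
have Kfin : nu K \is a fin_num by exact: fin_num_measure.
have p0 : 0 < fine (nu K).
  by rewrite fine_gt0// lt0e K0 measure_ge0/= ltey_eq Kfin.
have c0 : 0 <= (fine (nu K))^-1 by rewrite invr_ge0 ltW.
pose c := NngNum c0.
pose m : probability TR R := mnormalize (mrestr nu mK) nu.
have mE A : measurable A -> m A = (c%:num%:E * nu (A `&` K))%E.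
  (* the normalization falls back to [nu] when [nu K] is [0] or infinite *)
  have evK : mrestr nu mK setT = nu K by rewrite /mrestr setTI.
  move=> mA; change ((if (mrestr nu mK setT == 0) || (mrestr nu mK setT == +oo)
    then fun U => nu U
    else fun U => nu (U `&` K) * (fine (mrestr nu mK setT))^-1%:E) A =
    c%:num%:E * nu (A `&` K))%E.
  rewrite evK.
  by rewrite (negbTE K0) lt_eqF ?ltey_eq ?Kfin//= muleC.
have m_on A : measurable A -> A `<=` K -> m A = (c%:num%:E * nu A)%E.
  by move=> mA AK; rewrite mE// setIidl.
have m_off : m (~` K) = 0%E.
  by rewrite mE ?setICl ?measure0 ?mule0//; exact: measurableC.
have mK1 : m K = 1%E.
  by rewrite m_on// /c/= -[X in (_ * X)%E]fineK// -EFinM mulVf// gt_eqF.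
have c20 : 0 <= (c%:num) ^+ 2 by rewrite exprn_ge0.
have mm_on X : measurable X -> X `<=` K `*` K ->
    (m \x m)%E X = ((NngNum c20)%:num%:E * (nu \x nu)%E X)%E.
  by move=> mX XK; rewrite (product_restricted mK mE).
have mm_off := product_off mK mK1.
have [ki kE] := energy_kernelE nu_fin.
have m_fin : has_finite_energy u m.
  split.
  - move=> x; rewrite mE; last exact: measurable_set1.
    apply/eqP; rewrite mule_eq0; apply/orP; right; apply/eqP.
    apply: (@subset_measure0 _ _ _ nu _ [set x]); last exact: nu0.
    + by apply: measurableI => //; exact: measurable_set1.
    + exact: measurable_set1.
    + exact: subIsetl.
  - apply: (integrable_restricted mKK mm_on mm_off); last exact: measurable_int _ li.
    exact: integrableS li.
  - apply: (integrable_restricted mK m_on m_off); last exact: measurable_int _ ui.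
    exact: integrableS ui.
exists m; split => //.
have [_ <-] := energy_kernelE m_fin.
have kiK : (nu \x nu)%E.-integrable (K `*` K) (EFin \o energy_kernel u).
  exact: integrableS ki.
rewrite /Rintegral (integral_restricted mKK mm_on mm_off kiK (measurable_int _ ki)).
rewrite fineM//; last exact: integrable_fin_num.
by rewrite mulrA /= -exprMn divff ?expr1n ?mul1r// gt_eqF.
Qed.

(** [ln_le_linear] with a slope of at most [c / 4] spends half of the growth of
    the potential on the logarithm. *)
Lemma energy_kernel_coercive u (c D : R) : 0 < c -> 0 <= D ->
  (forall x, c * `|x| - D <= u x) ->
  exists C, forall z, c / 4 * Num.max `|z.1| `|z.2| - C <= energy_kernel u z.
Proof.
move=> c0 D0 uD; pose d := Num.min 1 (c / 4).
have d0 : 0 < d by rewrite lt_min ltr01 divr_gt0.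
have d1 : d <= 1 by rewrite ge_min lexx.
have dc : d <= c / 4 by rewrite ge_min lexx orbT.
have c4 : 0 <= c / 4 by rewrite divr_ge0// ltW.
exists (D - ln d) => z; rewrite /energy_kernel /log_gap.
have := ln_le_linear d0 d1 (normr_ge0 ((z.1 : R) - z.2)).
have := uD z.1; have := uD z.2; have := ler_normB (z.1 : R) (z.2 : R).
have := ler_wpM2r (normr_ge0 ((z.1 : R) - z.2)) dc.
set t := `|_ - _|; have := normr_ge0 (z.1 : R); have := normr_ge0 (z.2 : R).
move: `|z.1| `|z.2| => a b b0 a0 h1 h2 h3 h4 h5.
have h6 : c / 4 * t <= c / 4 * (a + b) by rewrite ler_wpM2l.
have h7 : c / 4 * Num.max a b <= c / 4 * (a + b).
  by rewrite ler_wpM2l// ge_max lerDl lerDr a0 b0.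
lra.
Qed.

Lemma mass_eq1 (p E I J : R) : 0 <= p <= 1 -> p ^+ 2 * E <= I ->
  (E + 1) * (1 - p ^+ 2) <= J -> E = I + J -> p = 1.
Proof. by move=> /andP[p0 p1] EI EJ EE; nra. Qed.

(** Outside a large square [K `*` K] the kernel exceeds the minimal energy [E]
    by [1].  Writing [p] for [nu K], the energy of [nu] is therefore at least
    [p^2 E + (1 - p^2) (E + 1)]: inside the square, the law conditioned on [K]
    has energy at least [E].  This forces [p = 1]. *)
Lemma minimizer_compact_support u nu (c D : R) : 0 < c -> 0 <= D ->
  (forall x, c * `|x| - D <= u x) ->
  has_finite_energy u nu -> gibbs_minimizer u nu ->
  exists2 M : R, 0 <= M & nu `[- M, M] = 1%E.
Proof.
move=> c0 D0 uD nu_fin nu_min.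
have [C kC] := energy_kernel_coercive c0 D0 uD.
have [ki kE] := energy_kernelE nu_fin.
set E := energy u nu in kE.
pose M := `|E + 1 + C| * (4 / c).
have M0 : 0 <= M by rewrite mulr_ge0// divr_ge0// ltW.
exists M => //.
set K : set TR := `[- M, M]%classic.
have mK : measurable K by exact: measurable_itv.
have mKK : measurable (K `*` K) by exact: measurableX.
have Kfin : nu K \is a fin_num by exact: fin_num_measure.
set p := fine (nu K).
have p01 : 0 <= p <= 1.
  by rewrite fine_ge0//= -lee_fin fineK// probability_le1.
have k_out z : (~` (K `*` K)) z -> E + 1 <= energy_kernel u z.
  move=> zK; apply: le_trans (kC z).
  have Mz : M <= Num.max `|z.1| `|z.2|.
    rewrite leNgt gt_max; apply/negP => /andP[z1 z2]; apply: zK.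
    by split; rewrite /K/= in_itv/= -ler_norml ltW.
  have : c / 4 * M <= c / 4 * Num.max `|z.1| `|z.2|.
    by rewrite ler_wpM2l// divr_ge0// ltW.
  have -> : c / 4 * M = `|E + 1 + C| by rewrite /M; field; rewrite gt_eqF.
  by have := ler_norm (E + 1 + C); lra.
have nuKp : nu K = p%:E by rewrite fineK.
have [KKE KKC] := product_square mK nuKp.
have in_ge : p ^+ 2 * E <= \int[(nu \x nu)%E]_(z in K `*` K) energy_kernel u z.
  have [K0|K0] := eqVneq (nu K) 0%E.
    rewrite /Rintegral (@null_set_integral _ _ _ (nu \x nu)%E)//.
    - by rewrite /p K0 /= expr0n mul0r.
    - exact: measurable_funTS (measurable_int _ ki).
    - by apply: (eq_trans KKE); rewrite /p K0/= expr0n.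
  have [m [m_fin ->]] := conditioned_energy mK K0 nu_fin.
  by rewrite ler_wpM2l ?sqr_ge0//; exact: minimizer_le.
have mKKC : measurable (~` (K `*` K)) by exact: measurableC.
have out_ge : (E + 1) * (1 - p ^+ 2) <=
    \int[(nu \x nu)%E]_(z in ~` (K `*` K)) energy_kernel u z.
  have -> : (E + 1) * (1 - p ^+ 2) =
      \int[(nu \x nu)%E]_(z in ~` (K `*` K)) (E + 1).
    rewrite Rintegral_cst//; congr (_ * _).
    by apply/esym; exact: (congr1 fine KKC).
  apply: le_Rintegral => //.
  - apply/integrableP; split; first exact: measurable_cst.
    rewrite [ltLHS](_ : _ = `|(E + 1)%:E| * (1 - p ^+ 2)%:E)%E.
      by rewrite -EFinM ltry.
    transitivity (`|(E + 1)%:E| * (nu \x nu)%E (~` (K `*` K)))%E.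
      exact: integral_cst.
    by congr (_ * _)%E; exact: KKC.
  - exact: integrableS ki.
have := @Rintegral_setU _ _ _ (nu \x nu)%E (K `*` K) (~` (K `*` K)) (energy_kernel u).
rewrite setUv kE => /(_ mKK mKKC ki); rewrite disj_set2E setICr eqxx => /(_ isT) sumE.
have p1 := mass_eq1 p01 in_ge out_ge sumE.
by rewrite -[LHS]fineK// -/p p1.
Qed.

End confinement.

(** * The first variation of the energy *)

Lemma eq0_of_parabola_ge0 (R : realType) (d C e0 : R) : 0 < e0 -> 0 <= C ->
  (forall e, `|e| <= e0 -> 0 <= e * d + C * e ^+ 2) -> d = 0.
Proof.
move=> e00 C0 parab; apply/eqP; apply: contraT => d0.
have nd : 0 < `|d| by rewrite normr_gt0.
(* along [e = - d * t] the parabola is [d ^+ 2 * t * (C * t - 1)] *)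
pose t := (C + 1 + `|d| / e0)^-1.
have s0 : 0 < C + 1 + `|d| / e0 by have := divr_gt0 nd e00; lra.
have t0 : 0 < t by rewrite invr_gt0.
have ts : t * (C + 1 + `|d| / e0) = 1 by rewrite mulVf// gt_eqF.
have Ct : C * t < 1.
  have : 0 < t * (1 + `|d| / e0).
    by rewrite mulr_gt0//; have := divr_gt0 nd e00; lra.
  by move: ts; rewrite !mulrDr; lra.
have te : `|- d * t| <= e0.
  have tde : t * (`|d| / e0) <= 1.
    have : 0 <= t * (C + 1) by rewrite mulr_ge0//; lra.
    by move: ts; rewrite [in X in X -> _]mulrDr; lra.
  rewrite normrM normrN (gtr0_norm t0).
  have -> : `|d| * t = t * (`|d| / e0) * e0 by field; rewrite gt_eqF.
  by rewrite -[leRHS]mul1r ler_wpM2r// ltW.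
have := parab _ te.
have -> : - d * t * d + C * (- d * t) ^+ 2 = d ^+ 2 * t * (C * t - 1) by ring.
rewrite leNgt pmulr_rlt0 ?subr_lt0 ?Ct// mulr_gt0// exprn_even_gt0//=.
Qed.

Lemma first_variation_ge0 (R : realType) (U G U1 l a b e P Q : R) :
  U - G <= U1 - (G + l) -> e * b - 2 * (e ^+ 2 * Q) <= l ->
  U1 <= U + e * a + P * e ^+ 2 -> 0 <= e * (a - b) + (P + 2 * Q) * e ^+ 2.
Proof. lra. Qed.

Section variation.
Context (R : realType).
Local Notation TR := (measurableTypeR R).
Context (g : R -> R) (B L : R).
Hypothesis mg : measurable_fun setT (g : TR -> TR).
Hypothesis B_ge0 : 0 <= B.
Hypothesis L_ge0 : 0 <= L.
Hypothesis g_bounded : forall s, `|g s| <= B.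
Hypothesis g_lipschitz : forall s t, `|g s - g t| <= L * `|s - t|.

Definition slope (f : R -> R) (z : TR * TR) : R :=
  (f z.1 - f z.2) / ((z.1 : R) - z.2).

Lemma measurable_slope : measurable_fun setT (slope g).
Proof.
apply: measurable_funM.
  apply: measurable_funB.
    exact: (measurableT_comp mg measurable_fst).
  exact: (measurableT_comp mg measurable_snd).
apply: (measurableT_comp (@measurable_invr R)).
by apply: measurable_funB; [exact: measurable_fst|exact: measurable_snd].
Qed.

Lemma slope_bounded z : `|slope g z| <= L.
Proof.
rewrite /slope; have [->|z12] := eqVneq (z.1 : R) z.2.
  by rewrite !subrr mul0r normr0.
rewrite normrM normfV ler_pdivrMr ?g_lipschitz//.
by rewrite normr_gt0 subr_eq0.
Qed.

Section shift.
Context (e : R).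
Hypothesis e_small : `|e| * L <= 1 / 2.

Definition shift_by (s : TR) : TR := s + e * g s.

Lemma measurable_shift_by : measurable_fun setT shift_by.
Proof.
apply: measurable_funD; first exact: measurable_id.
exact: measurable_funM.
Qed.

Lemma slope_small z : `|e * slope g z| <= 1 / 2.
Proof.
rewrite normrM; apply: le_trans e_small.
by rewrite ler_wpM2l// slope_bounded.
Qed.

Lemma shift_by_gap (z : TR * TR) :
  (shift_by z.1 : R) - shift_by z.2 = ((z.1 : R) - z.2) * (1 + e * slope g z).
Proof.
rewrite /shift_by /slope; have [->|z12] := eqVneq (z.1 : R) z.2.
  by rewrite !subrr mul0r.
by field; rewrite subr_eq0.
Qed.

(** The shift multiplies the gap [s - t] by [1 + e * slope g (s, t)].  The identity
    also holds on the diagonal, where all the terms vanish. *)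
Lemma log_gap_shift (z : TR * TR) :
  log_gap (shift_by z.1, shift_by z.2) = log_gap z + ln (1 + e * slope g z).
Proof.
have := slope_small z; rewrite ler_norml => /andP[es1 es2].
rewrite /log_gap/= shift_by_gap normrM (@gtr0_norm _ (1 + _)); last by lra.
have [z12|z12] := eqVneq (z.1 : R) z.2.
  rewrite /slope z12 !subrr mul0r mulr0 addr0 ln1 normr0 mul0r ln0//.
  by rewrite addr0.
by rewrite lnM ?posrE ?normr_gt0 ?subr_eq0//; lra.
Qed.

Lemma shift_by_inj : injective shift_by.
Proof.
move=> s t st; have := shift_by_gap (s, t); rewrite /= st subrr => /esym/eqP.
have := slope_small (s, t); rewrite ler_norml => /andP[es1 es2].
rewrite mulf_eq0 => /orP[/eqP/subr0_eq//|/eqP]; lra.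
Qed.

Lemma ln_slope_bounds z :
  e * slope g z - 2 * (e ^+ 2 * L ^+ 2) <= ln (1 + e * slope g z) <= 1 / 2.
Proof.
have := slope_small z; rewrite ler_norml => /andP[es1 es2].
apply/andP; split.
  apply: le_trans (ln1D_ge es1); rewrite lerD2l lerN2 ler_wpM2l// exprMn.
  rewrite ler_wpM2l ?sqr_ge0// -(ger0_norm (sqr_ge0 _)) normrX.
  by rewrite lerXn2r ?nnegrE// slope_bounded.
by apply: le_trans (le_ln1Dx _) _ => //; lra.
Qed.

Lemma measurable_ln_slope :
  measurable_fun setT (fun z : TR * TR => ln (1 + e * slope g z)).
Proof.
apply: (measurableT_comp (@measurable_ln R)); apply: measurable_funD => //.
by apply: measurable_funM => //; exact: measurable_slope.
Qed.

Lemma potential_shift (u : R -> R) (M C : R) : 0 <= C ->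
  (forall s h, `|s| <= M -> `|h| <= 1 ->
    u (s + h) - u s <= derive1 u s * h + C * h ^+ 2) ->
  forall s, `|s| <= M -> `|e| * B <= 1 ->
  u (shift_by s) <= u s + e * (derive1 u s * g s) + C * B ^+ 2 * e ^+ 2.
Proof.
move=> C0 uC s sM eB.
have egB : `|e * g s| <= 1.
  by rewrite normrM; apply: le_trans eB; rewrite ler_wpM2l.
have := uC s _ sM egB; rewrite /shift_by.
have gB2 : g s ^+ 2 <= B ^+ 2.
  by rewrite -(ger0_norm (sqr_ge0 (g s))) normrX lerXn2r ?nnegrE.
have := ler_wpM2l (mulr_ge0 C0 (sqr_ge0 e)) gB2.
rewrite exprMn; lra.
Qed.

End shift.

Context (u : R -> R) (nu : probability TR R) (M : R).
Local Notation u' := (derive1 u).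
Hypothesis u_C2 : C2 u.
Hypothesis nu_supp : nu `[- M, M] = 1%E.
Hypothesis nu_fin : has_finite_energy u nu.
Hypothesis nu_min : gibbs_minimizer u nu.

Let mK : measurable (`[- M, M] : set TR). Proof. exact: measurable_itv. Qed.

Let nu_off : nu (~` `[- M, M]) = 0%E.
Proof. exact: null_complement. Qed.

Lemma integrable_bounded_on_support (f : TR -> R) (C : R) : measurable_fun setT f ->
  (forall x, `|x| <= M -> `|f x| <= C) -> nu.-integrable setT (EFin \o f).
Proof.
move=> mf fC; apply: (integrable_bounded_on mK nu_off (C := C)) => //.
  by rewrite [ltLHS](_ : _ = 1%E) ?ltry//; exact: nu_supp.
by move=> x; rewrite /= in_itv/= => xM; rewrite fC// ler_norml.
Qed.

Lemma integrable_bounded_product (f : TR * TR -> R) (C : R) :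
  measurable_fun setT f -> (forall z, `|f z| <= C) ->
  (nu \x nu)%E.-integrable setT (EFin \o f).
Proof.
move=> mf fC.
apply: (@integrable_bounded_on _ _ _ (nu \x nu)%E setT _ _ _ C) => //.
  by rewrite setCT measure0.
by rewrite [ltLHS]product_setT ltry.
Qed.

Lemma integrable_ln_slope e : `|e| * L <= 1 / 2 ->
  (nu \x nu)%E.-integrable setT
    (EFin \o (fun z : TR * TR => ln (1 + e * slope g z))).
Proof.
move=> eL; apply: (@integrable_bounded_product _ (1 + 2 * (e ^+ 2 * L ^+ 2))).
  exact: measurable_ln_slope.
move=> z; have /andP[l1 l2] := ln_slope_bounds eL z.
have := slope_small eL z; rewrite !ler_norml => /andP[s1 s2].
have := mulr_ge0 (sqr_ge0 e) (sqr_ge0 L); lra.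
Qed.

Lemma integrable_shifted_potential e : `|e| * B <= 1 ->
  nu.-integrable setT (EFin \o (u \o shift_by e)).
Proof.
move=> eB; have uc := C2_continuous u_C2.
have [C C0 uC] := continuous_bounded_on (M + 1) uc.
apply: (@integrable_bounded_on_support (u \o shift_by e) C).
  apply: measurableT_comp; last exact: measurable_shift_by.
  exact: continuous_measurable_fun.
move=> s sM; apply: uC; apply: le_trans (ler_normD _ _) _.
rewrite lerD// normrM; apply: le_trans eB.
by rewrite ler_wpM2l.
Qed.

Lemma shifted_energy e : `|e| * L <= 1 / 2 -> `|e| * B <= 1 ->
  exists m, has_finite_energy u m /\
    energy u m = \int[nu]_s u (shift_by e s) -
      (\int[(nu \x nu)%E]_z log_gap z +
       \int[(nu \x nu)%E]_z ln (1 + e * slope g z)).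
Proof.
move=> eL eB; have [nu0 li ui] := nu_fin.
have mphi := measurable_shift_by e.
pose phi : {mfun TR >-> TR} := HB.pack (shift_by e) (isMeasurableFun.Build _ _ _ _ _ mphi).
pose m : probability TR R := distribution nu phi.
have mE A : measurable A -> m A = nu (shift_by e @^-1` A) by [].
have mmE := product_image mphi mE.
have mphi2 : measurable_fun setT (fun z : TR * TR => (shift_by e z.1, shift_by e z.2)).
  by apply: measurable_fun_pair; apply: measurableT_comp.
have mlg : measurable_fun setT (EFin \o @log_gap R).
  by apply/measurable_EFinP; exact: measurable_log_gap.
have uc := C2_continuous u_C2.
have mu : measurable_fun setT (u : TR -> R) by exact: continuous_measurable_fun.
have lni := integrable_ln_slope eL.
have lgE : (fun z : TR * TR => log_gap (shift_by e z.1, shift_by e z.2)) =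
    (fun z => log_gap z + ln (1 + e * slope g z)).
  by apply/funext => z; rewrite log_gap_shift.
have lgi : (nu \x nu)%E.-integrable setT
    (EFin \o (fun z : TR * TR => log_gap (shift_by e z.1, shift_by e z.2))).
  by rewrite lgE; exact: integrableD li lni.
exists m; split.
  split.
  - move=> x; rewrite mE; last exact: measurable_set1.
    have [[s <-]|xphi] := pselect (exists s, shift_by e s = x).
      rewrite (_ : _ @^-1` _ = [set s])//; apply/seteqP; split => t /=.
        exact: shift_by_inj.
      by move=> ->.
    rewrite (_ : _ @^-1` _ = set0) ?measure0//; apply/seteqP; split => t //= tx.
    by apply: xphi; exists t.
  - exact/(integrable_image mphi2 mmE mlg).
  - apply/(integrable_image mphi mE); first exact/measurable_EFinP.
    exact: integrable_shifted_potential.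
rewrite /energy; congr (_ - _).
  by rewrite /Rintegral (integral_image mphi mE)//; exact/measurable_EFinP.
rewrite -RintegralD// -lgE.
by rewrite /Rintegral (integral_image mphi2 mmE mlg).
Qed.

(** Moving the mass by [s + e * g s] cannot lower the energy, for [e] of either
    sign.  The logarithms change by [ln (1 + e * slope g)], so that the energy
    changes by at most [e * (\int u' g - \int\int slope g) + O(e ^+ 2)]. *)
Lemma schwinger_dyson :
  \int[nu]_s (u' s * g s) = \int[(nu \x nu)%E]_z slope g z.
Proof.
have [nu0 li ui] := nu_fin; have L0 := L_ge0; have B0 := B_ge0.
have [C C0 uC] := quadratic_upper_bound u_C2 M.
have uc := C2_continuous u_C2.
have u'c := C2_continuous' u_C2.
have mu : measurable_fun setT (u : TR -> R) by exact: continuous_measurable_fun.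
have mu' : measurable_fun setT (u' : TR -> R) by exact: continuous_measurable_fun.
have [D D0 u'D] := continuous_bounded_on M u'c.
have ugi : nu.-integrable setT (EFin \o (fun s => u' s * g s)).
  apply: (@integrable_bounded_on_support _ (D * B)); first exact: measurable_funM.
  by move=> s sM; rewrite normrM ler_pM// u'D.
have si : (nu \x nu)%E.-integrable setT (EFin \o slope g).
  apply: (@integrable_bounded_product _ L); first exact: measurable_slope.
  exact: slope_bounded.
apply/subr0_eq.
pose e0 := (2 * (1 + L + B))^-1.
have e0_gt0 : 0 < e0 by rewrite invr_gt0; lra.
have e0E : e0 * (2 * (1 + L + B)) = 1 by rewrite mulVf// gt_eqF//; lra.
apply: (@eq0_of_parabola_ge0 _ _ (C * B ^+ 2 + 2 * L ^+ 2) e0) => //.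
  by rewrite addr_ge0// mulr_ge0// sqr_ge0.
move=> e ee0.
have eL : `|e| * L <= 1 / 2.
  apply: le_trans (ler_wpM2r L_ge0 ee0) _.
  have := mulr_ge0 (ltW e0_gt0) B_ge0; have := mulr_ge0 (ltW e0_gt0) L_ge0; lra.
have eB : `|e| * B <= 1.
  apply: le_trans (ler_wpM2r B_ge0 ee0) _.
  have := mulr_ge0 (ltW e0_gt0) B_ge0; have := mulr_ge0 (ltW e0_gt0) L_ge0; lra.
have [m [m_fin mE]] := shifted_energy eL eB.
have := minimizer_le nu_fin nu_min m_fin; rewrite mE /energy.
have lni := integrable_ln_slope eL.
have esi : (nu \x nu)%E.-integrable setT (EFin \o (fun z => e * slope g z)).
  exact: (integrableZl measurableT e si).
have cst2 (a : R) : (nu \x nu)%E.-integrable setT (EFin \o (fun=> a)).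
  by apply: (@integrable_bounded_product _ `|a|) => //; exact: measurable_cst.
have cst1 (a : R) : nu.-integrable setT (EFin \o (fun=> a)).
  by apply: (@integrable_bounded_on_support _ `|a|) => //; exact: measurable_cst.
have int2 (a : R) : \int[(nu \x nu)%E]_z a = a.
  by rewrite Rintegral_cst// [X in fine X]product_setT mulr1.
have int1 (a : R) : \int[nu]_z a = a.
  by rewrite Rintegral_cst// [X in fine X]probability_setT mulr1.
have ln_ge : e * \int[(nu \x nu)%E]_z slope g z - 2 * (e ^+ 2 * L ^+ 2) <=
    \int[(nu \x nu)%E]_z ln (1 + e * slope g z).
  rewrite -(int2 (2 * (e ^+ 2 * L ^+ 2))) -RintegralZl// -RintegralB//.
  apply: le_Rintegral => //; first exact: integrableB esi (cst2 _).
  by move=> z _; have /andP[] := ln_slope_bounds eL z.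
have u_le : \int[nu]_s u (shift_by e s) <=
    \int[nu]_s u s + e * \int[nu]_s (u' s * g s) + C * B ^+ 2 * e ^+ 2.
  have usi := integrable_shifted_potential eB.
  have eugi : nu.-integrable setT (EFin \o (fun s => e * (u' s * g s))).
    exact: (integrableZl measurableT e ugi).
  have uugi : nu.-integrable setT (EFin \o (fun s => u s + e * (u' s * g s))).
    exact: integrableD ui eugi.
  rewrite -(int1 (C * B ^+ 2 * e ^+ 2)) -RintegralZl// -RintegralD// -RintegralD//.
  apply: (le_Rintegral_full mK nu_off usi); first exact: integrableD uugi (cst1 _).
  move=> s; rewrite /= in_itv/= => sM.
  have sM' : `|s| <= M by rewrite ler_norml.
  exact: potential_shift C0 uC _ sM' eB.
move=> min_le; exact: first_variation_ge0 min_le ln_ge u_le.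
Qed.

End variation.

(** * The Stein kernel *)

(** The retraction of the line onto [`[- M, M]]; it turns a locally Lipschitz
    function into a bounded Lipschitz one without changing it on the interval. *)
Definition clamp (R : realType) (M s : R) : R := Num.max (- M) (Num.min M s).

Lemma clamp_norm_le (R : realType) (M s : R) : 0 <= M -> `|clamp M s| <= M.
Proof.
by move=> M0; rewrite ler_norml le_max lexx/= ge_max ge_min lexx/= andbT; lra.
Qed.

Lemma clamp_id (R : realType) (M s : R) : `|s| <= M -> clamp M s = s.
Proof.
by rewrite ler_norml => /andP[Ms sM]; rewrite /clamp min_r// max_r.
Qed.

Lemma clamp_lipschitz (R : realType) (M s t : R) : 0 <= M ->
  `|clamp M s - clamp M t| <= `|s - t|.
Proof.
move=> M0; rewrite /clamp ler_norml.
have := ler_norm (s - t); have := ler_norm (- (s - t)); rewrite normrN.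
case: (leP M s) => Ms; case: (leP M t) => Mt.
- by case: (leP (- M) M) => ?; lra.
- by case: (leP (- M) M) => ?; case: (leP (- M) t) => ?; lra.
- by case: (leP (- M) M) => ?; case: (leP (- M) s) => ?; lra.
- by case: (leP (- M) s) => ?; case: (leP (- M) t) => ?; lra.
Qed.

Lemma poly_lipschitz_on (R : realType) (f : {poly R}) (M : R) :
  exists2 C, 0 <= C & forall x y, `|x| <= M -> `|y| <= M ->
    `|f.[x] - f.[y]| <= C * `|x - y|.
Proof.
apply: (@C1_lipschitz_on R (horner f)) => [x|]; first exact: derivable_horner.
rewrite (_ : derive1 (horner f) = horner (deriv f)).
  exact: continuous_horner.
apply/funext => x; rewrite derive1E.
by apply: derive_val; exact: is_derive_poly.
Qed.

Section stein.
Context (R : realType).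
Local Notation TR := (measurableTypeR R).
Context (mu nu : probability TR R) (u : R -> R).
Local Notation u' := (derive1 u).
Hypothesis u_C2 : C2 u.
Hypothesis u_pos : forall x, 0 < u^`(2) x.
Hypothesis nu_min : gibbs_minimizer u nu.
Hypothesis mu_image : forall B : set TR, measurable B ->
  mu B = nu (u' @^-1` B).

Let mu' : measurable_fun setT (u' : TR -> TR).
Proof. exact: continuous_measurable_fun (C2_continuous' u_C2). Qed.

Lemma atomless_preimage : mu `<< (@lebesgue_measure R) ->
  forall x, nu [set x] = 0%E.
Proof.
move=> mu_ac x; have := dominated_atomless mu_ac (u' x).
rewrite mu_image; last exact: measurable_set1.
rewrite (_ : _ @^-1` _ = [set x])//; apply/seteqP; split => y /=.
  exact: deriv_inj.
by move=> ->.
Qed.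

(** If [u'] had a constant sign, the image of [nu] under it would not be centered;
    so [u] decreases at [-oo], increases at [+oo], and convexity makes it grow at
    least linearly. *)
Lemma centered_coercive : centered mu -> compactly_supported mu ->
  exists c D, [/\ 0 < c, 0 <= D & forall x, c * `|x| - D <= u x].
Proof.
move=> mu_c [a [b mu_ab]].
have mab : measurable (`[a, b] : set TR) by exact: measurable_itv.
have mid : measurable_fun setT (fun x : TR => x%:E : \bar R).
  by apply/measurable_EFinP; exact: measurable_id.
have idi : mu.-integrable setT (EFin \o (fun x : TR => x : R)).
  apply: (integrable_bounded_on mab _ (C := `|a| + `|b|)).
  - exact: null_complement.
  - by rewrite [ltLHS](_ : _ = 1%E) ?ltry.
  - exact: measurable_id.
  move=> x; rewrite /= in_itv/= => /andP[ax xb].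
  rewrite ler_norml; have := ler_norm b; have := ler_norm (- a); rewrite normrN.
  have := normr_ge0 a; have := normr_ge0 b; lra.
have u'i : nu.-integrable setT (EFin \o (u' : TR -> R)).
  by have [+ _] := integrable_image mu' mu_image mid; apply.
have u'0 : (\int[nu]_x (u' x)%:E = 0)%E.
  by rewrite -mu_c (integral_image mu' mu_image).
have nsign (f : R -> R) : nu.-integrable setT (EFin \o (f : TR -> R)) ->
    (\int[nu]_x (f x)%:E = 0)%E -> ~ (forall x, 0 < f x).
  move=> fi f0 fpos.
  have : (\int[nu]_x `|(f x)%:E| = 0)%E.
    rewrite -f0; apply: eq_integral => x _.
    by rewrite gee0_abs// lee_fin ltW.
  move=> /(ae_eq_integral_abs nu measurableT (measurable_int _ fi)).
  move=> [N [mN N0 sub]].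
  have NT : N = setT.
    apply/seteqP; split => // x _; apply: sub => /= /(_ I)/eqP.
    by rewrite eqe gt_eqF.
  have := probability_setT nu; rewrite -NT N0 => /eqP.
  by rewrite eq_sym onee_eq0.
have [q q0] : exists q, 0 < u' q.
  apply: contrapT => npos; apply: (nsign (fun x => - u' x)).
  - exact: integrableN u'i.
  - under eq_integral do rewrite EFinN.
    by rewrite integralN ?u'0 ?oppe0//; apply: fin_num_adde_defl;
      rewrite ?fin_numN; exact: integrable_neg_fin_num.
  (* strict monotonicity: where [u'] is nonnegative, it is positive further on *)
  move=> x; rewrite oppr_gt0 ltNge; apply/negP => u'x.
  by apply: npos; exists (x + 1); apply: le_lt_trans u'x _; rewrite deriv_lt// ltrDl.
have [p p0] : exists p, u' p < 0.
  apply: contrapT => nneg; apply: (nsign u') => // x.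
  rewrite ltNge; apply/negP => u'x.
  by apply: nneg; exists (x - 1); apply: lt_le_trans u'x; rewrite deriv_lt// ltrBlDr ltrDl.
exact: coercive p0 q0.
Qed.

Context (M : R).
Hypothesis M_ge0 : 0 <= M.
Hypothesis nu_supp : nu `[- M, M] = 1%E.
Hypothesis nu_fin : has_finite_energy u nu.

Let K : set TR := `[- M, M]%classic.

Let mK : measurable K. Proof. exact: measurable_itv. Qed.

Let mKK : measurable (K `*` K). Proof. exact: measurableX. Qed.

Let mu'2 : measurable_fun setT (fun z : TR * TR => (u' z.1 : TR, u' z.2 : TR)).
Proof. by apply: measurable_fun_pair; apply: measurableT_comp. Qed.

Let mu2_image := product_image mu' mu_image.

Lemma measurable_horner (f : {poly R}) :
  measurable_fun setT (fun x : TR => f.[x] : TR).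
Proof. by apply: continuous_measurable_fun; exact: continuous_horner. Qed.

(** [schwinger_dyson] for the test function [f \o u'], which is bounded and
    Lipschitz once it is frozen outside the support of [nu]. *)
Lemma schwinger_dyson_poly (f : {poly R}) :
  (\int[nu]_s (u' s * f.[u' s])%:E =
   \int[nu \x nu]_z (slope (fun s => f.[u' s]) z)%:E)%E.
Proof.
pose h s := f.[u' s]; pose g s := h (clamp M s).
have [D D0 u'D] := continuous_bounded_on M (C2_continuous' u_C2).
have [C1 C10 u'L] := C1_lipschitz_on M (C2_derivable' u_C2) (C2_continuous'' u_C2).
have [Cf Cf0 fL] := poly_lipschitz_on f D.
have [B B0 fB] := continuous_bounded_on D (@continuous_horner R f).
have gB s : `|g s| <= B by rewrite fB// u'D// clamp_norm_le.
have gL s t : `|g s - g t| <= (Cf * C1) * `|s - t|.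
  have cs := clamp_norm_le s M_ge0; have ct := clamp_norm_le t M_ge0.
  apply: le_trans (fL _ _ (u'D _ cs) (u'D _ ct)) _.
  rewrite -mulrA ler_wpM2l//; apply: le_trans (u'L _ _ cs ct) _.
  by rewrite ler_wpM2l// clamp_lipschitz.
have mh : measurable_fun setT (h : TR -> TR).
  exact: measurableT_comp (measurable_horner f) mu'.
have mclamp : measurable_fun setT (clamp M : TR -> TR).
  apply: measurable_maxr; first exact: measurable_cst.
  by apply: measurable_minr; [exact: measurable_cst|exact: measurable_id].
have mg : measurable_fun setT (g : TR -> TR) by exact: measurableT_comp mh mclamp.
have CfC1 : 0 <= Cf * C1 by rewrite mulr_ge0.
have SD := schwinger_dyson mg B0 CfC1 gB gL u_C2 nu_supp nu_fin nu_min.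
have nu_off := null_complement mK nu_supp.
have nu2_off := product_off mK nu_supp.
have ugi : nu.-integrable setT (EFin \o (fun s => u' s * g s)).
  apply: (integrable_bounded_on_support nu_supp (C := D * B)); first exact: measurable_funM.
  by move=> s sM; rewrite normrM ler_pM// u'D.
have si : (nu \x nu)%E.-integrable setT (EFin \o slope g).
  apply: (integrable_bounded_product nu (C := Cf * C1)); first exact: measurable_slope.
  exact: slope_bounded.
transitivity (\int[nu]_s (u' s * g s)%:E)%E.
  apply: ae_eq_integral => //.
  - by apply/measurable_EFinP; apply: measurable_funM.
  - exact: measurable_int _ ugi.
  exists (~` K); split => //; first exact: measurableC.
  move=> s /=; apply: contra_not; rewrite /K/= in_itv/= -ler_norml => sM _.
  by rewrite /g clamp_id.
transitivity (\int[nu \x nu]_z (slope g z)%:E)%E.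
  by rewrite !integrable_EFin_fineK// SD.
apply/esym; apply: ae_eq_integral => //.
- by apply/measurable_EFinP; exact: measurable_slope.
- exact: measurable_int _ si.
exists (~` (K `*` K)); split => //; first exact: measurableC.
move=> z /=; apply: contra_not; rewrite /K/= !in_itv/= -!ler_norml => -[z1 z2] _.
by rewrite /slope /g !clamp_id.
Qed.

(** [S] stands for either of the two left inverses of [u'] in the theorem. *)
Variable S : R -> R.
Hypothesis mS : measurable_fun setT (S : TR -> TR).
Hypothesis SK : cancel u' S.

Definition inverse_slope (x y : R) : R := (x - y) / (S x - S y).

Lemma measurable_inverse_slope :
  measurable_fun setT (fun z : TR * TR => inverse_slope z.1 z.2).
Proof.
apply: measurable_funM.
  by apply: measurable_funB; [exact: measurable_fst|exact: measurable_snd].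
apply: (measurableT_comp (@measurable_invr R)); apply: measurable_funB.
  exact: (measurableT_comp mS measurable_fst).
exact: (measurableT_comp mS measurable_snd).
Qed.

Lemma inverse_slopeE (z : TR * TR) : inverse_slope (u' z.1) (u' z.2) = slope u' z.
Proof. by rewrite /inverse_slope !SK. Qed.

(** On the image of the support the kernel is a difference quotient of [u'], hence
    bounded by a Lipschitz constant of [u']. *)
Lemma inverse_slope_Lfun2 :
  (fun z : TR * TR => inverse_slope z.1 z.2) \in Lfun (mu \x mu)%E 2%:E.
Proof.
have mA := measurable_inverse_slope.
have mA2 : measurable_fun setT
    (fun z : TR * TR => (inverse_slope z.1 z.2 ^+ 2)%:E : \bar R).
  by apply/measurable_EFinP; exact: measurable_funX.
apply/andP; split; rewrite inE//=; rewrite /finite_norm unlock.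
apply: poweR_lty.
under eq_integral do rewrite abse_EFin poweR_EFin powR_mulrn// real_normK ?num_real//.
rewrite (ge0_integral_image mu'2 mu2_image mA2)/=; last first.
  by move=> z; rewrite lee_fin sqr_ge0.
under eq_integral do rewrite inverse_slopeE.
have [C C0 u'L] := C1_lipschitz_on M (C2_derivable' u_C2) (C2_continuous'' u_C2).
apply: integrable_lty; first exact: measurableT.
apply: (integrable_bounded_on mKK (product_off mK nu_supp) (C := C ^+ 2)).
- by rewrite [ltLHS](_ : _ = 1%E) ?ltry//; exact: product_on.
- by apply: measurable_funX; exact: measurable_slope.
move=> z; rewrite /K/= !in_itv/= -!ler_norml => -[z1 z2].
rewrite normrX lerXn2r ?nnegrE// /slope.
have [->|z12] := eqVneq (z.1 : R) z.2; first by rewrite !subrr mul0r normr0.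
rewrite normrM normfV ler_pdivrMr ?u'L//.
by rewrite normr_gt0 subr_eq0.
Qed.

Lemma measurable_diff_quotient (f : {poly R}) :
  measurable_fun setT (fun z : TR * TR => diff_quotient f z.1 z.2).
Proof.
apply: measurable_fun_ifT.
- by apply: measurable_fun_eqr; [exact: measurable_fst|exact: measurable_snd].
- exact: (measurableT_comp (measurable_horner _) measurable_fst).
apply: measurable_funM.
  apply: measurable_funB.
    exact: (measurableT_comp (measurable_horner f) measurable_fst).
  exact: (measurableT_comp (measurable_horner f) measurable_snd).
apply: (measurableT_comp (@measurable_invr R)).
by apply: measurable_funB; [exact: measurable_fst|exact: measurable_snd].
Qed.

(** Off the diagonal, [u' s != u' t] and the denominator of the difference
    quotient of [f] cancels the numerator of the kernel. *)
Lemma stein_equation (f : {poly R}) :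
  (\int[mu]_x (derive1 (@semicircular_potential R) x * f.[x])%:E =
   \int[mu \x mu]_z (inverse_slope z.1 z.2 * diff_quotient f z.1 z.2)%:E)%E.
Proof.
have -> : derive1 (@semicircular_potential R) = id.
  apply/funext => x; rewrite derive1E; apply: derive_val.
  apply/is_derive1_caratheodory; exists (fun z => (z + x) / 2); split.
  - by move=> z; rewrite /semicircular_potential; field.
  - apply: cvgM; last exact: cvg_cst.
    by apply: cvgD; [exact: cvg_id|exact: cvg_cst].
  - by field.
have mA := measurable_inverse_slope; have mq := measurable_diff_quotient f.
have mf := measurable_horner f.
have mxf : measurable_fun setT (fun x : TR => (id x * f.[x])%:E : \bar R).
  by apply/measurable_EFinP; apply: measurable_funM => //; exact: measurable_id.
have mAq : measurable_fun setT
    (fun z : TR * TR => (inverse_slope z.1 z.2 * diff_quotient f z.1 z.2)%:E : \bar R).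
  by apply/measurable_EFinP; exact: measurable_funM.
rewrite (integral_image mu' mu_image mxf) (integral_image mu'2 mu2_image mAq).
rewrite [LHS](schwinger_dyson_poly f).
have [nu0 _ _] := nu_fin; have [mD D0] := diagonal_null nu0.
have mfu' : measurable_fun setT ((fun s => f.[u' s]) : TR -> TR).
  exact: measurableT_comp mf mu'.
apply: ae_eq_integral => //.
- by apply/measurable_EFinP; exact: measurable_slope.
- exact: (measurableT_comp mAq mu'2).
exists [set z | z.1 = z.2]; split => // z /=; apply: contra_notP => z12 _.
rewrite inverse_slopeE /slope /diff_quotient/=.
have z12' : (z.1 : R) != z.2 by exact/eqP.
have u'12 : u' z.1 != u' z.2 by apply: contra_neq z12'; exact: deriv_inj.
by rewrite (negbTE u'12); congr _%:E; field; rewrite !subr_eq0 z12' u'12.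
Qed.

Lemma inverse_slope_stein_kernel :
  is_free_stein_kernel mu (@semicircular_potential R) inverse_slope.
Proof. by split; [exact: inverse_slope_Lfun2|exact: stein_equation]. Qed.

End stein.

Theorem theorem5 (R : realType) (mu : probability (measurableTypeR R) R)
    (u : R -> R)
    (mu_centered : centered mu)
    (mu_ac : mu `<< (@lebesgue_measure R))
    (mu_supp : compactly_supported mu)
    (mu_u : is_free_moment_map mu u)
    (u_C2 : C2 u)
    (u_pos : forall x, 0 < u^`(2) x) :
  [/\ forall y, range u^`() y ->
        is_derive y 1 (fine \o legendre u) (pinv [set: R] u^`() y),
      is_free_stein_kernel mu (@semicircular_potential R)
        (fun x y => (x - y) / (legendre_deriv u x - legendre_deriv u y)) &
      is_free_stein_kernel mu (@semicircular_potential R)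
        (fun x y => (x - y) /
           (pinv [set: R] u^`() x - pinv [set: R] u^`() y))].
Proof.
have [_ [nu [nu_min _] mu_image]] := mu_u.
have nu0 := atomless_preimage u_C2 u_pos mu_image mu_ac.
have [c [D [c0 D0 uD]]] :=
  centered_coercive u_C2 u_pos mu_image mu_centered mu_supp.
have nu_fin := minimizer_has_finite_energy (C2_continuous u_C2) nu0 nu_min.
have [M M0 nuM] := minimizer_compact_support c0 D0 uD nu_fin nu_min.
have kernel S mS SK := @inverse_slope_stein_kernel R mu nu u u_C2 u_pos nu_min
  mu_image M M0 nuM nu_fin S mS SK.
split.
- move=> _ [x _ <-]; rewrite (pinv_derivK u_C2 u_pos).
  exact: is_derive_legendre.
- apply: kernel; first exact: measurable_legendre_deriv.
  exact: legendre_deriv_at.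
- apply: kernel; first exact: measurable_pinv_deriv.
  exact: pinv_derivK.
Qed.
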